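(* Let $T=\{1324,2341,4123\}$. Then \[ F_T(x)=C(x)+\frac{x^3 - 3 x^4 +3 x^5 -5 x^6 + 9 x^7 -4 x^8}{(1-x)^6 (1-2x)^2}, \] where $C(x)=\frac{1-\sqrt{1-4x}}{2x}$ is the generating function of the Catalan numbers.
   Context: A permutation $\pi\in S_n$ contains a pattern $\tau\in S_k$ if some subsequence of $\pi$ of length $k$ is order-isomorphic to $\tau$; otherwise $\pi$ avoids $\tau$. For a set $T$ of patterns, $S_n(T)$ is the set of permutations of $[n]$ avoiding every pattern in $T$, and $F_T(x)=\sum_{n\ge0}|S_n(T)|x^n$ (with $|S_0(T)|=1$). *)

(* Defs.v *)
From HB Require Import structures.
From mathcomp Require Import all_boot all_order all_fingroup all_algebra.
From mathcomp Require Import boolp.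
Set Implicit Arguments.
Unset Strict Implicit.
Unset Printing Implicit Defensive.
Import GRing.Theory.
Local Open Scope ring_scope.

(** * Permutation patterns *)

Definition contains (n k : nat) (pi : 'S_n) (tau : 'S_k) : bool :=
  [exists f : {ffun 'I_k -> 'I_n},
     [forall i : 'I_k, forall j : 'I_k, (i < j)%N ==> (f i < f j)%N] &&
     [forall i : 'I_k, forall j : 'I_k, (pi (f i) < pi (f j))%N == (tau i < tau j)%N]].

Definition avoiders (n k : nat) (T : {set 'S_k}) : {set 'S_n} :=
  [set pi : 'S_n | [forall tau in T, ~~ contains pi tau]].

(* 'S_n permutes {0, ..., n-1}, hence the shift to the values 1, ..., n. *)
Definition oneline (n : nat) (pi : 'S_n) : seq nat := [seq (pi i).+1 | i : 'I_n].

Definition T_1324_2341_4123 : {set 'S_4} :=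
  [set tau : 'S_4 | oneline tau \in
     [:: [:: 1; 3; 2; 4]; [:: 2; 3; 4; 1]; [:: 4; 1; 2; 3]]%N].

(** * Formal power series over a field *)

Record fps (K : fieldType) := FPS { coefs : nat -> K }.

(* The value at n of the sequence defined by course-of-values recursion: step
   maps the list of the values at 0, ..., n-1 to the value at n. *)
Fixpoint cov_prefix (A : Type) (step : seq A -> A) (n : nat) : seq A :=
  if n is m.+1 then rcons (cov_prefix step m) (step (cov_prefix step m)) else [::].
Definition cov (A : Type) (step : seq A -> A) (n : nat) : A :=
  step (cov_prefix step n).

Lemma size_cov_prefix (A : Type) (step : seq A -> A) n :
  size (cov_prefix step n) = n.
Proof. by elim: n => //= n IH; rewrite size_rcons IH. Qed.

Lemma nth_cov_prefix (A : Type) (x0 : A) (step : seq A -> A) n i :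
  (i < n)%N -> nth x0 (cov_prefix step n) i = cov step i.
Proof.
elim: n => //= n IH; rewrite ltnS leq_eqVlt nth_rcons size_cov_prefix.
by case/predU1P => [->|lt_in]; rewrite ?ltnn ?eqxx // lt_in IH.
Qed.

Section PowerSeries.
Context {K : fieldType}.
Implicit Types f g h : fps K.

HB.instance Definition _ := gen_eqMixin (fps K).
HB.instance Definition _ := gen_choiceMixin (fps K).

Lemma fpsP f g : (forall n, coefs f n = coefs g n) -> f = g.
Proof. by case: f g => [f] [g] /= E; congr FPS; apply/funext. Qed.

Definition fps_add f g := FPS (fun n => coefs f n + coefs g n).
Definition fps_opp f := FPS (fun n => - coefs f n).
Definition fps_const (c : K) := FPS (fun n => if n is 0%N then c else 0).
Definition fps_mul f g :=
  FPS (fun n => \sum_(i < n.+1) coefs f i * coefs g (n - i)%N).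

Lemma fps_addA : associative fps_add.
Proof. by move=> f g h; apply: fpsP => n /=; rewrite addrA. Qed.
Lemma fps_addC : commutative fps_add.
Proof. by move=> f g; apply: fpsP => n /=; rewrite addrC. Qed.
Lemma fps_add0 : left_id (fps_const 0) fps_add.
Proof. by move=> f; apply: fpsP => -[|n] /=; rewrite add0r. Qed.
Lemma fps_addN : left_inverse (fps_const 0) fps_opp fps_add.
Proof. by move=> f; apply: fpsP => -[|n] /=; rewrite addNr. Qed.

HB.instance Definition _ :=
  GRing.isZmodule.Build (fps K) fps_addA fps_addC fps_add0 fps_addN.

Definition fps_trunc n f : {poly K} := \poly_(i < n.+1) coefs f i.

Lemma coef_fps_trunc n f i : (i <= n)%N -> (fps_trunc n f)`_i = coefs f i.
Proof. by move=> le_in; rewrite coef_poly ltnS le_in. Qed.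

Lemma fps_mul_trunc n f g i : (i <= n)%N ->
  coefs (fps_mul f g) i = (fps_trunc n f * fps_trunc n g)`_i.
Proof.
move=> le_in; rewrite coefM /=; apply: eq_bigr => j _.
rewrite !coef_fps_trunc //; first exact: leq_trans (leq_subr _ _) le_in.
by apply: leq_trans le_in; rewrite -ltnS.
Qed.

Lemma fps_mulC : commutative fps_mul.
Proof.
by move=> f g; apply: fpsP => n; rewrite !(@fps_mul_trunc n) // mulrC.
Qed.

Lemma fps_mulA : associative fps_mul.
Proof.
have aux f g h n : coefs (fps_mul (fps_mul f g) h) n =
    (fps_trunc n f * fps_trunc n g * fps_trunc n h)`_n.
  rewrite coefM; apply: eq_bigr => j _.
  by rewrite coef_fps_trunc ?leq_subr // (@fps_mul_trunc n) // -ltnS.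
move=> f g h; apply: fpsP => n.
by rewrite fps_mulC !aux mulrC mulrA.
Qed.

Lemma fps_mul1 : left_id (fps_const 1) fps_mul.
Proof.
move=> f; apply: fpsP => n /=.
by rewrite big_ord_recl /= mul1r subn0 big1 ?addr0 // => i _; rewrite mul0r.
Qed.

Lemma fps_mulDl : left_distributive fps_mul fps_add.
Proof.
move=> f g h; apply: fpsP => n /=; rewrite -big_split /=.
by apply: eq_bigr => i _; rewrite mulrDl.
Qed.

Lemma fps_one_neq0 : fps_const 1 != 0.
Proof. by apply/eqP => /(congr1 (fun f => coefs f 0)) /eqP; rewrite oner_eq0. Qed.

HB.instance Definition _ := GRing.Zmodule_isComNzRing.Build (fps K)
  fps_mulA fps_mulC fps_mul1 fps_mulDl fps_one_neq0.

Definition fps_unit : pred (fps K) := fun f => coefs f 0 != 0.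

Definition fps_inv_step f (s : seq K) : K :=
  ((size s == 0%N)%:R - \sum_(i < size s) s`_i * coefs f (size s - i)%N) / coefs f 0.

Definition fps_inv f :=
  if fps_unit f then FPS (cov (fps_inv_step f)) else f.

Lemma fps_mulVr : {in fps_unit, left_inverse 1 fps_inv *%R}.
Proof.
move=> f uf; have f0 : coefs f 0 != 0 by []; apply: fpsP => n.
rewrite /fps_inv (uf : fps_unit f) [LHS]/= big_ord_recr /= subnn.
rewrite {2}/cov /fps_inv_step size_cov_prefix divfK //.
rewrite addrC -[RHS]addr0 -addrA; congr (_ + _); first by case: n.
rewrite addrC; apply/eqP; rewrite subr_eq0; apply/eqP.
by apply: eq_bigr => i _; rewrite nth_cov_prefix.
Qed.

Lemma fps_unitP f g : g * f = 1 -> fps_unit f.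
Proof.
move=> /(congr1 (fun f => coefs f 0)); rewrite /= big_ord1 /fps_unit => E.
by apply/eqP => f0; move/eqP: E; rewrite f0 mulr0 eq_sym oner_eq0.
Qed.

Lemma fps_inv_out : {in [predC fps_unit], fps_inv =1 id}.
Proof. by move=> f; rewrite /fps_inv => /negbTE uf; rewrite (uf : fps_unit f = false). Qed.

HB.instance Definition _ := GRing.ComNzRing_hasMulInverse.Build (fps K)
  fps_mulVr fps_unitP fps_inv_out.

Lemma fps_unitE f : (f \is a GRing.unit) = (coefs f 0 != 0).
Proof. by []. Qed.

Definition fps_X : fps K := FPS (fun n => (n == 1%N)%:R).

(* Division by X of a series with zero constant term. *)
Definition fps_divX f : fps K := FPS (fun n => coefs f n.+1).

Lemma fps_divXK f : coefs f 0 = 0 -> fps_X * fps_divX f = f.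
Proof.
move=> f0; apply: fpsP => -[|n] /=; first by rewrite big_ord1 mul0r f0.
rewrite 2!big_ord_recl /= mul0r add0r mul1r subSS subn0.
by rewrite big1 ?addr0 // => i _; rewrite mul0r.
Qed.

(* The square root with constant term 1 of a series with constant term 1. *)
Definition fps_sqrt_step f (s : seq K) : K :=
  if s is [::] then 1 else
  (coefs f (size s) - \sum_(1 <= i < size s) s`_i * s`_(size s - i)) / 2.

Definition fps_sqrt f : fps K := FPS (cov (fps_sqrt_step f)).

Lemma coefs_fps_sqrtS f n : coefs (fps_sqrt f) n.+1 =
  (coefs f n.+1 - \sum_(1 <= i < n.+1)
     coefs (fps_sqrt f) i * coefs (fps_sqrt f) (n.+1 - i)%N) / 2.
Proof.
rewrite [LHS]/= /cov /fps_sqrt_step.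
case E: (cov_prefix _ n.+1) => [|a s].
  by move/(congr1 size): E; rewrite size_cov_prefix.
rewrite -E size_cov_prefix; congr ((_ - _) / _).
apply: eq_big_nat => i /andP[i_gt0 lt_in].
by rewrite !nth_cov_prefix // ltn_subrL i_gt0.
Qed.

Lemma fps_sqrtK f : 2 != 0 :> K -> coefs f 0 = 1 -> fps_sqrt f ^+ 2 = f.
Proof.
move=> K2 f0; rewrite expr2; apply: fpsP => n.
transitivity (\sum_(0 <= i < n.+1)
    coefs (fps_sqrt f) i * coefs (fps_sqrt f) (n - i)%N).
  by rewrite big_mkord.
have s0 : coefs (fps_sqrt f) 0 = 1 by [].
case: n => [|n]; first by rewrite big_nat1 subnn s0 mulr1 f0.
move: (coefs_fps_sqrtS f n) s0; move: (coefs (fps_sqrt f)) => s Es s0.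
rewrite big_ltn // big_nat_recr //= subnn subn0 s0 mul1r mulr1.
by rewrite addrCA -mulr2n -mulr_natr Es divfK // addrC subrK.
Qed.
End PowerSeries.

Arguments fps_X K : clear implicits.

Definition perm_gf (k : nat) (T : {set 'S_k}) : fps rat :=
  FPS (fun n => #|avoiders n T|%:R).

Definition catalan_gf : fps rat :=
  fps_divX ((1 - fps_sqrt (1 - 4 * fps_X rat)) / 2).

Lemma catalan_gfE : 2 * fps_X rat * catalan_gf = 1 - fps_sqrt (1 - 4 * fps_X rat).
Proof.
have u2 : (2 : fps rat) \is a GRing.unit by [].
rewrite -mulrA fps_divXK; first by rewrite mulrC divrK.
rewrite [LHS]big_ord1.
have -> : coefs (1 - fps_sqrt (1 - 4 * fps_X rat)) 0 = 0 by exact: subrr.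
exact: mul0r.
Qed.

(* Main.v *)
Require Import Defs.
From mathcomp Require Import all_boot all_fingroup zify.
Set Implicit Arguments.
Unset Strict Implicit.
Unset Printing Implicit Defensive.

(** A permutation avoiding 123 avoids T, because each pattern of T contains
    123, and there are Catalan many of these.  It remains to count the
    permutations that avoid T and contain 123.  Both classes are generated by
    repeatedly appending a new last entry.  Say that s is a site of p if
    inserting the last value s (and shifting the values >= s) keeps p in the
    class Av(T).  After appending at s, an old site t <= s survives unless p has
    an ascending pair with values in [t, s), and an old site t >= s survives
    unless p has an ascending pair a < s <= c < t or an entry c >= t to the left
    of an entry a < s.  The evolution of the sites thus depends only on these
    two relations between sites.  The words from which 123 can still be reached,
    or has been reached, then fall into finitely many families, each with at
    most one integer parameter on which the number of descendants depends
    affinely; this gives a finite linear system for the generating functions. *)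

(** * Pattern occurrences in words *)

(* Words list the entries from right to left, so that appending is [cons]; the
   arguments of [R] come in positional order, the reverse of the list order. *)
Fixpoint occ2 (R : nat -> nat -> bool) (p : seq nat) : bool :=
  if p is x :: p' then has (R^~ x) p' || occ2 R p' else false.

Fixpoint occ3 (R : nat -> nat -> nat -> bool) (p : seq nat) : bool :=
  if p is x :: p' then occ2 (fun a b => R a b x) p' || occ3 R p' else false.

Fixpoint occ4 (R : nat -> nat -> nat -> nat -> bool) (p : seq nat) : bool :=
  if p is x :: p' then occ3 (fun a b c => R a b c x) p' || occ4 R p' else false.

Lemma eq_occ2 R R' p : R =2 R' -> occ2 R p = occ2 R' p.
Proof.
by move=> eqR; elim: p => //= x p ->; congr orb; apply: eq_has => a; apply: eqR.
Qed.

Lemma eq_occ3 R R' p : (forall a b c, R a b c = R' a b c) -> occ3 R p = occ3 R' p.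
Proof.
by move=> eqR; elim: p => //= x p ->; congr orb; apply: eq_occ2 => a b.
Qed.

Lemma occ2_map R f p : occ2 R (map f p) = occ2 (fun a b => R (f a) (f b)) p.
Proof. by elim: p => //= x p ->; rewrite has_map. Qed.

Lemma occ3_map R f p :
  occ3 R (map f p) = occ3 (fun a b c => R (f a) (f b) (f c)) p.
Proof. by elim: p => //= x p ->; rewrite occ2_map. Qed.

Lemma occ4_map R f p :
  occ4 R (map f p) = occ4 (fun a b c d => R (f a) (f b) (f c) (f d)) p.
Proof. by elim: p => //= x p ->; rewrite occ3_map. Qed.

Lemma sub_occ2 (R R' : nat -> nat -> bool) p :
  (forall a b, R a b -> R' a b) -> occ2 R p -> occ2 R' p.
Proof.
move=> sub; elim: p => //= x p IH /orP[/hasP[a ap Ra]|/IH ->]; last exact: orbT.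
by apply/orP; left; apply/hasP; exists a => //; apply: sub.
Qed.

Lemma sub_occ3 (R R' : nat -> nat -> nat -> bool) p :
  (forall a b c, R a b c -> R' a b c) -> occ3 R p -> occ3 R' p.
Proof.
move=> sub; elim: p => //= x p IH /orP[Rx|/IH ->]; last exact: orbT.
by rewrite (sub_occ2 _ Rx) // => a b; apply: sub.
Qed.

Lemma occ2U R R' p :
  occ2 (fun a b => R a b || R' a b) p = occ2 R p || occ2 R' p.
Proof. by elim: p => //= x p ->; rewrite has_predU orbACA. Qed.

Lemma occ3U R R' p :
  occ3 (fun a b c => R a b c || R' a b c) p = occ3 R p || occ3 R' p.
Proof. by elim: p => //= x p ->; rewrite occ2U orbACA. Qed.

Lemma occ2_has R p : occ2 R p -> has (fun b => has (R^~ b) p) p.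
Proof.
elim: p => //= x p IH /orP[/hasP[a ap Ra]|/IH/hasP[b bp /hasP[a ap Ra]]].
  by apply/orP; left; apply/orP; right; apply/hasP; exists a.
apply/orP; right; apply/hasP; exists b => //.
by apply/orP; right; apply/hasP; exists a.
Qed.

Lemma occ3_weaken2 (R : nat -> nat -> nat -> bool) (R' : nat -> nat -> bool) p :
  (forall a b c, R a b c -> R' a b) -> occ3 R p -> occ2 R' p.
Proof.
move=> sub; elim: p => //= x p IH /orP[Rx|/IH ->]; last exact: orbT.
by rewrite (sub_occ2 _ Rx) ?orbT // => a b; apply: sub.
Qed.

Definition mono123 a b c := a < b < c.

(** This is meant for [badT]: the increasing triples allowed here are 134 in 1324, 234 in 2341 and
    123 in 4123, so it makes every 123-avoiding word avoid T. *)
Lemma occ4_123 (R : nat -> nat -> nat -> nat -> bool) p :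
  (forall a b c d, R a b c d -> [|| mono123 a b c, mono123 a b d | mono123 b c d]) ->
  occ4 R p -> occ3 mono123 p.
Proof.
have aux1 (S : nat -> nat -> nat -> bool) (S' : nat -> nat -> bool) q :
    (forall a b c, S a b c -> S' b c) -> occ3 S q -> occ2 S' q.
  move=> sub; elim: q => //= x q IH /orP[/occ2_has/hasP[b bq /hasP[a aq Sx]]|/IH ->].
    by apply/orP; left; apply/hasP; exists b => //; apply: sub Sx.
  exact: orbT.
move=> sub; elim: p => //= x p IH /orP[Rx|/IH ->]; last exact: orbT.
(* With [x] as fourth entry, a triple through [x] leaves an ascending pair in [p] below [x]; the
   remaining triple is already a 123 in [p]. *)
have: occ3 (fun a b c => mono123 a b c || (mono123 a b x || mono123 b c x)) p.
  by apply: sub_occ3 Rx => a b c; apply: sub.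
rewrite !occ3U => /or3P[->|Sx|Sx]; first exact: orbT.
  by apply/orP; left; apply: occ3_weaken2 Sx => a b c.
by apply/orP; left; apply: aux1 Sx => a b c.
Qed.

(** * Appending a last entry *)

Definition append (s : nat) (p : seq nat) : seq nat := s :: map (bump s) p.

Definition has123 (p : seq nat) : bool := occ3 mono123 p.

(* The disjuncts are 1324, 2341 and 4123. *)
Definition badT (a b c d : nat) : bool :=
  [|| (a < c < b) && (b < d), (d < a < b) && (b < c) | (b < c < d) && (d < a)].

Definition avoidsT (p : seq nat) : bool := ~~ occ4 badT p.

Definition site (p : seq nat) (s : nat) : bool :=
  (s <= size p) &&
  ~~ occ3 (fun a b c =>
       [|| (a < c < b) && (b < s), (s <= a < b) && (b < c)
         | (b < c < s) && (s <= a)]) p.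

Definition asc_in (p : seq nat) (u v : nat) : bool :=
  occ2 (fun a b => (u <= a < b) && (b < v)) p.

Definition shut (p : seq nat) (v w : nat) : bool :=
  occ2 (fun a b => (a < v <= b) && (b < w) || (b < v) && (w <= a)) p.

Definition is_word (p : seq nat) : Prop := forall a, (a \in p) = (a < size p).

Lemma size_append s p : size (append s p) = (size p).+1.
Proof. by rewrite /= size_map. Qed.

Lemma is_word_append s p : is_word p -> s <= size p -> is_word (append s p).
Proof.
move=> wp le_s a; rewrite size_append inE.
have [->|ne_as] /= := eqVneq a s; first by rewrite ltnS le_s.
apply/mapP/idP => [[b]|lt_a]; first by rewrite wp /bump => ? ->; lia.
exists (unbump s a); last by rewrite unbumpK.
by rewrite wp /unbump; lia.
Qed.

Lemma has123_append s p :
  s <= size p -> has123 (append s p) = asc_in p 0 s || has123 p.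
Proof.
move=> le_s; rewrite /has123 /= occ2_map occ3_map; congr orb.
  by apply: eq_occ2 => a b; rewrite /mono123 /bump; lia.
by apply: eq_occ3 => a b c; rewrite /mono123 /bump; lia.
Qed.

Lemma avoidsT_append s p :
  s <= size p -> avoidsT (append s p) = site p s && avoidsT p.
Proof.
move=> le_s; rewrite /avoidsT /site le_s /= occ3_map occ4_map negb_or.
congr andb; congr negb.
  by apply: eq_occ3 => a b c; rewrite /badT /bump; lia.
elim: p {le_s} => //= x p ->; congr orb.
by apply: eq_occ3 => a b c; rewrite /badT /bump; lia.
Qed.

(** An occurrence that the old site does not exclude has the appended [s] as third and [x] as fourth
    entry. If [x <= s] it can only be 2341; otherwise it is 1324 or 4123. Old sites above [s] have
    moved up by one, whence [x.-1]; the old site [s] can reappear both as [s] and as [s.+1]. *)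
Lemma site_append p s x : s <= size p ->
  site (append s p) x =
    if x <= s then site p x && ~~ asc_in p x s
    else site p x.-1 && ~~ shut p s x.-1.
Proof.
move=> le_s; rewrite /site size_append /= occ2_map occ3_map negb_or.
rewrite /asc_in /shut; case: leqP => xs.
  have -> : x <= (size p).+1 by lia.
  have -> : x <= size p by lia.
  rewrite !andTb andbC; congr andb; congr negb.
    by apply: eq_occ3 => a b c; rewrite /bump; lia.
  by apply: eq_occ2 => a b; rewrite /bump; lia.
have -> : (x <= (size p).+1) = (x.-1 <= size p) by lia.
rewrite -andbA; congr andb; rewrite andbC; congr andb; congr negb.
  by apply: eq_occ3 => a b c; rewrite /bump; lia.
by apply: eq_occ2 => a b; rewrite /bump; lia.
Qed.

(** Old pairs are shifted; a new pair has [s] as its upper end. Since a word contains every value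
    below its size, a lower end in [u, s) exists as soon as [u < s]. *)
Lemma asc_in_append p s u v : is_word p -> s <= size p ->
  asc_in (append s p) u v =
    asc_in p (unbump s u) (unbump s v) || (u < s < v).
Proof.
move=> wp le_s; rewrite /asc_in /= occ2_map orbC has_map; congr orb.
  by apply: eq_occ2 => a b; rewrite /bump /unbump; lia.
apply/hasP/idP => [[a _] /=|usv]; first by rewrite /bump; lia.
by exists u; rewrite ?wp /= /bump; lia.
Qed.

Lemma shut_append p s v w : is_word p -> s <= size p -> v <= w ->
  shut (append s p) v w =
    [|| shut p (unbump s v) (unbump s w), (0 < v <= s) && (s < w)
      | (s < v) && (w <= size p)].
Proof.
move=> wp le_s vw; rewrite /shut /= occ2_map orbC has_map; congr orb.
  by apply: eq_occ2 => a b; rewrite /bump /unbump; lia.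
apply/hasP/idP => [[a] /=|H]; first by rewrite wp /bump; lia.
have [ws|ws] := leqP w s.
  by lia.
(* The partner of the new entry [s] is an entry at least [w] when [s < v], and one below [v]
   otherwise: [w.-1] is bumped to [w], while 0 stays 0. *)
have [sv|sv] := ltnP s v; first by exists w.-1; rewrite ?wp /= /bump; lia.
by exists 0; rewrite ?wp /= /bump; lia.
Qed.

Lemma site_le p s : site p s -> s <= size p.
Proof. by case/andP. Qed.

Lemma asc_in_ge p u v : v <= u -> asc_in p u v = false.
Proof.
move=> vu; apply/negbTE; apply/negP => /occ2_has/hasP[b _ /hasP[a _]]; lia.
Qed.

Lemma asc_in_le p u u' v v' : u' <= u -> v <= v' -> asc_in p u v -> asc_in p u' v'.
Proof. by move=> ? ?; apply: sub_occ2 => a b; lia. Qed.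

Lemma shut0 p w : shut p 0 w = false.
Proof.
apply/negbTE; apply/negP => /occ2_has/hasP[b _ /hasP[a _]]; lia.
Qed.

Fixpoint count_desc (Q : pred (seq nat)) (p : seq nat) (r : nat) : nat :=
  if r is r'.+1 then \sum_(0 <= s < (size p).+1) count_desc Q (append s p) r'
  else Q p.

Lemma count_desc0 (P Q : pred (seq nat)) p r :
  (forall s q, s <= size q -> P q -> P (append s q)) ->
  (forall q, P q -> ~~ Q q) -> P p -> count_desc Q p r = 0.
Proof.
move=> hereditary PQ; elim: r p => [|r IH] p Pp /=; first by rewrite (negbTE (PQ _ Pp)).
by rewrite big_nat big1 // => s /andP[_ ?]; apply: IH; apply: hereditary.
Qed.

Definition mixed (p : seq nat) : bool := has123 p && avoidsT p.

Definition live (p : seq nat) : Prop := is_word p /\ avoidsT p.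

Lemma live_append p s : live p -> site p s -> live (append s p).
Proof.
case=> wp Tp sp; have le_s := site_le sp.
by split; [apply: is_word_append | rewrite avoidsT_append // sp].
Qed.

Lemma count_mixed0 p : live p -> count_desc mixed p 0 = has123 p.
Proof. by case=> _ Tp; rewrite /= /mixed Tp andbT. Qed.

(** Appending off a site creates a pattern of T, which later entries cannot remove, so only the
    sites contribute. *)
Lemma count_mixedS p r l : uniq l -> (forall s, (s \in l) = site p s) ->
  count_desc mixed p r.+1 = \sum_(s <- l) count_desc mixed (append s p) r.
Proof.
move=> ul ml /=; rewrite big_nat.
rewrite (bigID (site p)) /= [X in _ + X]big1 ?addn0; last first.
  move=> s /andP[hs nsp]; have le_s : s <= size p by lia.
  apply: (@count_desc0 (fun q => ~~ avoidsT q)).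
  - by move=> t q le_t nT; rewrite avoidsT_append // negb_and nT orbT.
  - by move=> q; rewrite /mixed negb_and orbC => ->.
  - by rewrite avoidsT_append // negb_and nsp.
rewrite -big_nat_cond -big_filter; apply: perm_big; apply: uniq_perm => //.
  by rewrite filter_uniq // iota_uniq.
move=> s; rewrite mem_filter mem_index_iota ml /= ltnS.
by apply: andb_idr; apply: site_le.
Qed.

(** * Updating the relations below, across and above the new entry *)

Section Append.
Variables (p : seq nat) (s : nat).
Hypotheses (wp : is_word p) (le_s : s <= size p).

Lemma site_append_le t : t <= s ->
  site (append s p) t = site p t && ~~ asc_in p t s.
Proof. by move=> ts; rewrite site_append // ts. Qed.

Lemma site_append_gt t : s <= t ->
  site (append s p) t.+1 = site p t && ~~ shut p s t.
Proof. by move=> st; rewrite site_append // ltnNge st. Qed.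

Lemma asc_in_append_le u v : u <= v <= s ->
  asc_in (append s p) u v = asc_in p u v.
Proof.
move=> uvs; rewrite asc_in_append // /unbump.
have [-> -> ->] : [/\ (s < u) = false, (s < v) = false
  & (u < s < v) = false] by split; lia.
by rewrite !subn0 orbF.
Qed.

Lemma asc_in_append_mid u v : u <= s <= v ->
  asc_in (append s p) u v.+1 = asc_in p u v || (u < s).
Proof.
move=> usv; rewrite asc_in_append // /unbump.
have [-> -> ->] : [/\ (s < u) = false, (s < v.+1) = true
  & (u < s < v.+1) = (u < s)] by split; lia.
by rewrite subn0 subn1.
Qed.

Lemma asc_in_append_gt u v : s <= u <= v ->
  asc_in (append s p) u.+1 v.+1 = asc_in p u v.
Proof.
move=> suv; rewrite asc_in_append // /unbump.
have [-> -> ->] : [/\ (s < u.+1) = true, (s < v.+1) = true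
  & (u.+1 < s < v.+1) = false] by split; lia.
by rewrite !subn1 orbF.
Qed.

Lemma shut_append_le u v : u <= v <= s ->
  shut (append s p) u v = shut p u v.
Proof.
move=> uvs; rewrite shut_append //; last by lia.
rewrite /unbump.
have [-> -> -> ->] : [/\ (s < u) = false, (s < v) = false,
  (0 < u <= s) && false = false & false && (v <= size p) = false] by split; lia.
by rewrite !subn0 ?orbF.
Qed.

Lemma shut_append_mid u v : u <= s <= v ->
  shut (append s p) u v.+1 = shut p u v || (0 < u).
Proof.
move=> usv; rewrite shut_append //; last by lia.
rewrite /unbump.
have [-> ->] : (s < u) = false /\ (s < v.+1) = true by split; lia.
by rewrite subn0 subn1 /=; lia.
Qed.

Lemma shut_append_gt u v : s <= u <= v ->
  shut (append s p) u.+1 v.+1 = shut p u v || (v < size p).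
Proof.
move=> suv; rewrite shut_append //; last by lia.
rewrite /unbump.
have [-> ->] : (s < u.+1) = true /\ (s < v.+1) = true by split; lia.
by rewrite !subn1 /=; lia.
Qed.
End Append.

(** * Words that contain 123 *)

(* In [two_sites] and [three_sites], [x] and [y] tell whether the smallest and
   the largest site survives only below the new entry, instead of splitting in
   two, when it is used. *)
Definition one_site p u : Prop :=
  [/\ live p, has123 p, forall t, site p t = (t == u) & shut p u u].

Definition two_sites (x y : bool) p u w : Prop :=
  [/\ live p /\ has123 p, u < w, forall t, site p t = (t == u) || (t == w),
      asc_in p u w = false &
      [/\ shut p u w, shut p u u = x, shut p w w = y & ~~ y -> w = size p]].

Definition three_sites (x y : bool) p u v w : Prop :=
  [/\ live p /\ has123 p, u < v < w,
      forall t, site p t = [|| t == u, t == v | t == w],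
      [/\ asc_in p u v = false, asc_in p u w & asc_in p v w = false] &
      [/\ shut p u v /\ shut p u w, shut p v w, shut p u u = x, shut p v v = false &
          shut p w w = y /\ (~~ y -> w = size p)]].

Lemma has123_appendW p s : s <= size p -> has123 p -> has123 (append s p).
Proof. by move=> le_s h; rewrite has123_append // h orbT. Qed.

Lemma asc_in_id p u : asc_in p u u = false.
Proof. exact: asc_in_ge. Qed.

Lemma shut_gt0 p v w : shut p v w -> 0 < v.
Proof. by case: v => // /negPf; rewrite shut0. Qed.

(* [lia] would split on every boolean of the context. *)
Ltac nat_lia := repeat match goal with
  | H : live _ |- _ => clear H
  | H : is_word _ |- _ => clear H
  | H : is_true (avoidsT _) |- _ => clear H
  | H : forall _, _ |- _ => clear H
  | H : forall _ _, _ |- _ => clear H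
  | H : @eq bool (site _ _) _ |- _ => clear H
  | H : @eq bool (has123 _) _ |- _ => clear H
  | H : @eq bool (asc_in _ _ _) _ |- _ => clear H
  | H : @eq bool (shut _ _ _) _ |- _ => clear H
  | H : is_true (site _ _) |- _ => clear H
  | H : is_true (has123 _) |- _ => clear H
  | H : is_true (asc_in _ _ _) |- _ => clear H
  | H : is_true (shut _ _ _) |- _ => clear H
  end; lia.

Ltac site_cases u v w t :=
  have [?|?] := eqVneq t u; [subst t|
  have [?|?] := eqVneq t v; [subst t|
  have [?|?] := eqVneq t w; [subst t|]]].

(** Determines the sites after appending at [s], by comparing each candidate with the old sites [u],
    [v], [w]; one of these is repeated when there are fewer than three. The mutual relations of the
    old sites are passed as [facts]. *)
Ltac sites Es s u v w facts :=
  let t := fresh "t" in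
  move=> t; case: (leqP t s) => ?;
    [ rewrite site_append_le // Es; site_cases u v w t
    | destruct t as [|t]; [by []|]; rewrite site_append_gt // Es; site_cases u v w t ];
  rewrite ?facts ?asc_in_id //=; try nat_lia.

Lemma one_site_append p u : one_site p u -> one_site (append u p) u.
Proof.
case=> lp hp Es shu; have su : site p u by rewrite Es eqxx.
have le_u := site_le su; have wp := lp.1.
split.
- exact: live_append.
- exact: has123_appendW.
- by sites Es u u u u shu.
- by rewrite shut_append_le ?leqnn.
Qed.

(** The relation [shut p u w] kills [w], and [u] splits unless [shut p u u]. After a split, the new
    last entry [u] and an earlier larger entry shut [u.+1] against itself, so [u.+1] will not
    split. *)
Lemma two_sites_append_low x y p u w : two_sites x y p u w ->
  if x then one_site (append u p) u else two_sites false true (append u p) u u.+1.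
Proof.
case=> -[lp hp] uw Es auw [suw suu sww szw].
have su : site p u by rewrite Es eqxx.
have sw : site p w by rewrite Es eqxx orbT.
have le_u := site_le su; have le_w := site_le sw; have wp := lp.1.
have u0 := shut_gt0 suw.
have [la ha] : live (append u p) /\ has123 (append u p).
  by split; [apply: live_append | apply: has123_appendW].
case: x suu => suu; split=> //.
- by sites Es u u w u (auw, suw, suu, sww).
- by rewrite shut_append_le ?leqnn.
- by sites Es u u w u (auw, suw, suu, sww).
- by rewrite asc_in_append_mid ?leqnn // ltnn asc_in_ge.
- split=> //.
  + by rewrite shut_append_mid ?leqnn // u0 orbT.
  + by rewrite shut_append_le ?leqnn.
  + by rewrite shut_append_gt ?leqnn //; nat_lia.
Qed.

(** No ascent lies in [u, w), so [u] survives. If [w] splits, the new entry [w] closes an ascent in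
    [u, w.+1): a later use of [w.+1] will kill [u]. The hypothesis [x ==> y] excludes the case where
    only [w] splits. *)
Lemma two_sites_append_high x y p u w : two_sites x y p u w -> x ==> y ->
  if y then two_sites x true (append w p) u w
  else three_sites false false (append w p) u w w.+1.
Proof.
case=> -[lp hp] uw Es auw [suw suu sww szw].
have su : site p u by rewrite Es eqxx.
have sw : site p w by rewrite Es eqxx orbT.
have le_u := site_le su; have le_w := site_le sw; have wp := lp.1.
have u0 := shut_gt0 suw.
have [la ha] : live (append w p) /\ has123 (append w p).
  by split; [apply: live_append | apply: has123_appendW].
case: y sww szw => sww szw.
  move=> _; split=> //.
  - by sites Es w u w u (auw, suw, suu, sww).
  - by rewrite asc_in_append_le //; nat_lia.
  - by split=> //; rewrite shut_append_le //; nat_lia.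
case: x suu => // suu _; split=> //.
- by nat_lia.
- by sites Es w u w u (auw, suw, suu, sww).
- split.
  + by rewrite asc_in_append_le //; nat_lia.
  + by rewrite asc_in_append_mid //; nat_lia.
  + by rewrite asc_in_append_mid ?asc_in_ge //; nat_lia.
- split.
  + by split; [rewrite shut_append_le | rewrite shut_append_mid] => //; nat_lia.
  + by rewrite shut_append_mid //; nat_lia.
  + by rewrite shut_append_le //; nat_lia.
  + by rewrite shut_append_le //; nat_lia.
  + have szp := szw isT.
    split; last by rewrite size_append; nat_lia.
    by rewrite shut_append_gt ?leqnn ?sww //; nat_lia.
Qed.

Lemma three_sites_append_low x y p u v w : three_sites x y p u v w ->
  if x then one_site (append u p) u else two_sites false true (append u p) u u.+1.
Proof.
case=> -[lp hp] uvw Es [auv auw avw] [[suv suw] svw suu svv [sww szw]].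
have su : site p u by rewrite Es eqxx.
have sw : site p w by rewrite Es eqxx !orbT.
have le_u := site_le su; have le_w := site_le sw; have wp := lp.1.
have u0 := shut_gt0 suw.
have [la ha] : live (append u p) /\ has123 (append u p).
  by split; [apply: live_append | apply: has123_appendW].
case: x suu => suu; split=> //.
- by sites Es u u v w (auv, auw, avw, suv, suw, svw, suu, svv, sww).
- by rewrite shut_append_le ?leqnn.
- by sites Es u u v w (auv, auw, avw, suv, suw, svw, suu, svv, sww).
- by rewrite asc_in_append_mid ?leqnn // ltnn asc_in_ge.
- split=> //.
  + by rewrite shut_append_mid ?leqnn // u0 orbT.
  + by rewrite shut_append_le ?leqnn.
  + by rewrite shut_append_gt ?leqnn //; nat_lia.
Qed.

(** The old [w] is shut and [v] splits, so [v.+1] takes the role of the largest site. It can no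
    longer split, since the new entry [v] follows an entry above it. *)
Lemma three_sites_append_mid x y p u v w : three_sites x y p u v w ->
  three_sites x true (append v p) u v v.+1.
Proof.
case=> -[lp hp] uvw Es [auv auw avw] [[suv suw] svw suu svv [sww szw]].
have su : site p u by rewrite Es eqxx.
have sv : site p v by rewrite Es eqxx !orbT.
have sw : site p w by rewrite Es eqxx !orbT.
have le_v := site_le sv; have le_w := site_le sw; have wp := lp.1.
have u0 := shut_gt0 suw.
have [la ha] : live (append v p) /\ has123 (append v p).
  by split; [apply: live_append | apply: has123_appendW].
split=> //.
- by nat_lia.
- by sites Es v u v w (auv, auw, avw, suv, suw, svw, suu, svv, sww).
- split.
  + by rewrite asc_in_append_le //; nat_lia.
  + by rewrite asc_in_append_mid //; nat_lia.
  + by rewrite asc_in_append_mid ?asc_in_ge //; nat_lia.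
- split.
  + by split; [rewrite shut_append_le | rewrite shut_append_mid] => //; nat_lia.
  + by rewrite shut_append_mid //; nat_lia.
  + by rewrite shut_append_le //; nat_lia.
  + by rewrite shut_append_le //; nat_lia.
  + by rewrite shut_append_gt //=; nat_lia.
Qed.

(** An ascent in [u, w) kills [u], while [v] survives because there is none in [v, w). *)
Lemma three_sites_append_high x y p u v w : three_sites x y p u v w ->
  if y then two_sites false true (append w p) v w
  else three_sites false false (append w p) v w w.+1.
Proof.
case=> -[lp hp] uvw Es [auv auw avw] [[suv suw] svw suu svv [sww szw]].
have sv : site p v by rewrite Es eqxx !orbT.
have sw : site p w by rewrite Es eqxx !orbT.
have le_v := site_le sv; have le_w := site_le sw; have wp := lp.1.
have v0 := shut_gt0 svw.
have [la ha] : live (append w p) /\ has123 (append w p).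
  by split; [apply: live_append | apply: has123_appendW].
case: y sww szw => sww szw; split=> //.
- by nat_lia.
- by sites Es w u v w (auv, auw, avw, suv, suw, svw, suu, svv, sww).
- by rewrite asc_in_append_le //; nat_lia.
- by split=> //; rewrite shut_append_le //; nat_lia.
- by nat_lia.
- by sites Es w u v w (auv, auw, avw, suv, suw, svw, suu, svv, sww).
- split.
  + by rewrite asc_in_append_le //; nat_lia.
  + by rewrite asc_in_append_mid //; nat_lia.
  + by rewrite asc_in_append_mid ?asc_in_ge //; nat_lia.
- split.
  + by split; [rewrite shut_append_le | rewrite shut_append_mid] => //; nat_lia.
  + by rewrite shut_append_mid //; nat_lia.
  + by rewrite shut_append_le //; nat_lia.
  + by rewrite shut_append_le //; nat_lia.
  + have szp := szw isT.
    split; last by rewrite size_append; nat_lia.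
    by rewrite shut_append_gt ?leqnn ?sww //; nat_lia.
Qed.

(** The three summands come from using the smallest, the middle and the largest of the three
    sites. *)
Fixpoint n_three (x y : bool) (r : nat) : nat :=
  if r is r'.+1 then
    (if x then 1 else 2 ^ r') + n_three x true r' +
    (if y then 2 ^ r' else n_three false false r')
  else 1.

Fixpoint n_two (r : nat) : nat :=
  if r is r'.+1 then 2 ^ r' + n_three false false r' else 1.

Lemma count_one_site p u r : one_site p u -> count_desc mixed p r = 1.
Proof.
elim: r p => [|r IH] p Hp; have [lp hp Es _] := Hp; first by rewrite count_mixed0 ?hp.
rewrite (@count_mixedS _ _ [:: u]) //=; last by move=> s; rewrite Es inE.
by rewrite big_seq1 IH //; apply: one_site_append.
Qed.

Lemma count_two_sitesS x y p u w r : two_sites x y p u w ->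
  count_desc mixed p r.+1 =
    count_desc mixed (append u p) r + count_desc mixed (append w p) r.
Proof.
case=> -[lp _] uw Es _ _; rewrite (@count_mixedS _ _ [:: u; w]) //=.
- by rewrite big_cons big_seq1.
- by rewrite inE andbT ltn_eqF.
- by move=> s; rewrite Es !inE.
Qed.

Lemma count_two_sites0 x y p u w : two_sites x y p u w -> count_desc mixed p 0 = 1.
Proof. by case=> -[lp hp] _ _ _ _; rewrite count_mixed0 ?hp. Qed.

(** Both children belong to the same family again, so the count doubles at each step. *)
Lemma count_two_sites01 p u w r : two_sites false true p u w ->
  count_desc mixed p r = 2 ^ r.
Proof.
elim: r p u w => [|r IH] p u w Hp; first exact: count_two_sites0 Hp.
rewrite (count_two_sitesS _ Hp) expnS mul2n -addnn.
by rewrite (IH _ _ _ (two_sites_append_low Hp)) (IH _ _ _ (two_sites_append_high Hp isT)).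
Qed.

Lemma count_two_sites11 p u w r : two_sites true true p u w ->
  count_desc mixed p r = r.+1.
Proof.
elim: r p u w => [|r IH] p u w Hp; first exact: count_two_sites0 Hp.
rewrite (count_two_sitesS _ Hp) (IH _ _ _ (two_sites_append_high Hp isT)).
by rewrite (count_one_site _ (two_sites_append_low Hp)).
Qed.

Lemma count_three_sites x y p u v w r : three_sites x y p u v w ->
  count_desc mixed p r = n_three x y r.
Proof.
elim: r x y p u v w => [|r IH] x y p u v w Hp; have [[lp hp] uvw Es _ _] := Hp.
  by rewrite count_mixed0 ?hp.
rewrite (@count_mixedS _ _ [:: u; v; w]) //=; last 2 first.
- by rewrite !inE; lia.
- by move=> s; rewrite Es !inE.
rewrite !big_cons big_nil addn0 addnA; congr (_ + _ + _).
- have := three_sites_append_low Hp; case: (x) => H; first exact: count_one_site H.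
  exact: count_two_sites01 H.
- exact: IH (three_sites_append_mid Hp).
- have := three_sites_append_high Hp; case: (y) => H; last exact: IH H.
  exact: count_two_sites01 H.
Qed.

Lemma count_two_sites00 p u w r : two_sites false false p u w ->
  count_desc mixed p r = n_two r.
Proof.
case: r => [|r] Hp; first exact: count_two_sites0 Hp.
rewrite (count_two_sitesS _ Hp) (count_two_sites01 _ (two_sites_append_low Hp)).
by rewrite (count_three_sites _ (two_sites_append_high Hp isT)).
Qed.

(** * Words that avoid 123 but from which it can be reached *)

(* Appending at a site s > 0 of a quiet word kills all the sites above s. *)
Definition quiet p : Prop :=
  forall v w, site p v -> site p w -> 0 < v -> v <= w -> shut p v w.

(* Sites of a cold word never create 123; [t] is the only site of a warm word
   that does, and then [u] is the only other site that survives. *)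
Definition cold p : Prop :=
  [/\ live p /\ 0 < size p, has123 p = false, quiet p &
      forall t, site p t -> asc_in p 0 t = false].

Definition warm p t u : Prop :=
  [/\ live p /\ 0 < size p, has123 p = false, quiet p &
      [/\ site p t, site p u /\ u < t, forall v, site p v -> v <= t,
          forall v, site p v -> asc_in p 0 v = (v == t) &
          forall v, site p v -> v < t -> asc_in p v t = (v != u)]].

(** A new smallest last entry can only be the 1 of 2341, whose first three entries would form a
    123. *)
Lemma site0 p : has123 p = false -> site p 0.
Proof.
move=> hp; rewrite /site leq0n /=; apply/negP => bad; move/negP: hp; apply.
by apply: sub_occ3 bad => a b c; rewrite /mono123; lia.
Qed.

Lemma site_append_quiet p s t : is_word p -> site p s -> 0 < s -> quiet p ->
  site (append s p) t = (t <= s) && (site p t && ~~ asc_in p t s).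
Proof.
move=> wp ss s0 qp; have le_s := site_le ss.
case: (leqP t s) => ts; first by rewrite site_append_le.
case: t ts => // t ts; rewrite site_append_gt //.
by case: (boolP (site p t)) => //= st; rewrite qp.
Qed.

Lemma quiet_append p s : is_word p -> site p s -> 0 < s -> quiet p ->
  quiet (append s p).
Proof.
move=> wp ss s0 qp v w; rewrite !site_append_quiet //.
move=> /and3P[vs sv _] /and3P[ws sw _] v0 vw.
by rewrite shut_append_le ?qp ?vw ?ws //; apply: site_le.
Qed.

Lemma shut_lt p v w : is_word p -> shut p v w -> w <= v -> w < size p.
Proof.
move=> wp /occ2_has/hasP[b bp /hasP[a ap /= R]] wv.
by move: ap bp; rewrite !wp; lia.
Qed.

(** For [t > 0], the relation [shut p t t] can only come from a descent across [t], which requires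
    an entry at least [t]. *)
Lemma quiet_site_lt p t : is_word p -> quiet p -> site p t -> 0 < size p -> t < size p.
Proof.
move=> wp qp st p0; case: (posnP t) => [->//|t0].
exact: shut_lt wp (qp t t st st t0 (leqnn t)) (leqnn t).
Qed.

(** The new 0 stands to the right of an entry at least as large as any site, and this descent shuts
    all pairs of positive sites. *)
Lemma quiet_append0 p : is_word p -> 0 < size p -> quiet p -> quiet (append 0 p).
Proof.
move=> wp p0 qp [|v] [|w] // sv; rewrite site_append_gt // => /andP[sw _] _ vw.
by rewrite shut_append_gt // quiet_site_lt ?orbT.
Qed.

Lemma has123_append_cold p s : s <= size p -> has123 p = false ->
  asc_in p 0 s = false -> has123 (append s p) = false.
Proof. by move=> le_s hp cs; rewrite has123_append // cs. Qed.

(** Only sites up to [s] survive, and every new ascent has upper end [s], so it lies below none of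
    them. *)
Lemma cold_append_pos p s : live p -> has123 p = false -> quiet p -> site p s ->
  0 < s -> (forall t, t <= s -> site p t -> asc_in p 0 t = false) ->
  cold (append s p).
Proof.
move=> lp hp qp ss s0 cp; have [wp _] := lp; have le_s := site_le ss.
split.
- by split; [apply: live_append|].
- by rewrite has123_append_cold ?cp.
- exact: quiet_append.
- move=> t; rewrite site_append_quiet // => /and3P[ts st _].
  by rewrite asc_in_append_le ?cp.
Qed.

Lemma count_cold p r : cold p -> count_desc mixed p r = 0.
Proof.
elim: r p => [|r IH] p [[lp p0] hp qp cp]; first by rewrite count_mixed0 ?hp.
rewrite (@count_mixedS _ _ [seq s <- iota 0 (size p).+1 | site p s]) //; first last.
- by move=> s; rewrite mem_filter mem_iota /= ltnS; apply/andb_idr/site_le.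
- by rewrite filter_uniq ?iota_uniq.
rewrite big_seq big1 // => s; rewrite mem_filter => /andP[ss _]; apply: IH.
have [wp _] := lp; have le_s := site_le ss.
case: (posnP s) => [Es|s0]; last by apply: cold_append_pos => // t _; apply: cp.
subst s; split.
- by split; [apply: live_append|].
- by rewrite has123_append_cold ?cp.
- exact: quiet_append0.
- case=> [|t]; first by rewrite asc_in_id.
  by rewrite site_append_gt // => /andP[st _]; rewrite asc_in_append_mid // cp.
Qed.

(** The triangular numbers: the summand [r] counts the descendants, after [r'] further steps, of a
    word with two sites that do not split. *)
Fixpoint n_warm (r : nat) : nat := if r is r'.+1 then n_warm r' + r else 0.

Lemma warm_append0 p t u : warm p t u -> warm (append 0 p) t.+1 u.+1.
Proof.
case=> [[lp p0] hp qp [st [su ut] tmax ct dt]].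
have [wp Tp] := lp; have s0 := site0 hp.
have c0 : asc_in p 0 0 = false by exact: asc_in_id.
split.
- by split; [apply: live_append|].
- by rewrite has123_append_cold.
- exact: quiet_append0.
- split.
  + by rewrite site_append_gt // st shut0.
  + by rewrite site_append_gt // su shut0.
  + by case=> // v; rewrite site_append_gt // => /andP[/tmax].
  + case=> [|v]; first by rewrite asc_in_id.
    by rewrite site_append_gt // => /andP[sv _]; rewrite asc_in_append_mid // ct // orbF.
  + case=> [|v]; first by rewrite asc_in_append_mid // ct // eqxx.
    rewrite site_append_gt // => /andP[sv _] vt.
    by rewrite asc_in_append_gt ?dt //; lia.
Qed.

Lemma warm_append_top p t u : warm p t u -> two_sites true true (append t p) u t.
Proof.
case=> [[lp p0] hp qp [st [su ut] tmax ct dt]].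
have [wp Tp] := lp; have le_t := site_le st.
(* If [u] were 0, the ascents below [t] would have to exist, as [t] creates 123, and not to exist,
   as [u] survives [t]. *)
have u0 : 0 < u.
  by case: (posnP u) (dt _ su ut) => // ->; rewrite ct // eqxx.
have aut : asc_in p u t = false by rewrite dt // eqxx.
have t0 : 0 < t by exact: leq_trans ut.
split=> //.
- by split; [exact: live_append | rewrite has123_append // ct // eqxx].
- move=> v; rewrite site_append_quiet //; apply/and3P/idP => [[vt sv av]|].
    have [->|nvt] := eqVneq v t; first by rewrite orbT.
    by rewrite orbF -[v == u]negbK -dt // ltn_neqAle nvt.
  by case/orP => /eqP->; rewrite ?leqnn ?asc_in_id ?aut // ltnW.
- by rewrite asc_in_append_le // leqnn ltnW.
- by split=> //; rewrite shut_append_le ?qp ?leqnn // ltnW.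
Qed.

Lemma count_warm p t u r : warm p t u -> count_desc mixed p r = n_warm r.
Proof.
elim: r p t u => [|r IH] p t u Hp; have [[lp p0] hp qp [st [su ut] tmax ct dt]] := Hp.
  by rewrite count_mixed0 ?hp.
have [wp Tp] := lp; have s0 := site0 hp.
rewrite (@count_mixedS _ _ (0 :: t :: [seq s <- iota 1 t.-1 | site p s])) //; first last.
- move=> s; rewrite !inE mem_filter mem_iota.
  have [->|ns0] := eqVneq s 0; first by rewrite s0.
  have [->|nst] := eqVneq s t; first by rewrite st.
  by case: (boolP (site p s)) => //= /tmax; lia.
- rewrite /= !inE !mem_filter !mem_iota filter_uniq ?iota_uniq //; lia.
rewrite !big_cons big_seq big1 => [|s].
  by rewrite addn0 /= (IH _ _ _ (warm_append0 Hp))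
    (count_two_sites11 _ (warm_append_top Hp)).
rewrite mem_filter mem_iota => /andP[ss hs]; apply: count_cold.
apply: cold_append_pos => //; first by lia.
by move=> v vs sv; rewrite ct //; lia.
Qed.

(** * Skew sums with one or two nontrivial blocks *)

Fixpoint n_layered (d : bool) (j r : nat) : nat :=
  if r is r'.+1 then
    n_layered d j.+1 r' + j * n_layered true 0 r' +
    (if d then n_two r' else n_three true false r')
  else 0.

(* The shape is a skew sum of blocks (i-1)...0 i with some nontrivial block (one
   that is not the whole word); [d] tells whether there are two of them, [j] is
   the least lower end of an ascending pair and, unless [d], [m] is the site
   that survives together with the top site when the latter creates 123. *)
Definition layered (d : bool) p j m : Prop :=
  let n := size p in
  [/\ live p /\ has123 p = false,
      j < n /\ (forall s, s <= j -> site p s) /\ site p n,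
      forall v w, site p v -> site p w -> 0 < v -> v <= w < n -> shut p v w,
      (forall s, s <= j -> shut p s n = false) /\ shut p n n = false /\
        (forall s, site p s -> j < s < n -> shut p s n) &
      [/\ forall s, site p s -> s < n -> asc_in p 0 s = false,
          forall s, s <= j -> asc_in p s n,
          ~~ d -> site p m /\ j < m < n &
          forall s, site p s -> j < s < n -> asc_in p s n = d || (s != m)]].

Lemma layered_append0 d p j m : layered d p j m -> layered d (append 0 p) j.+1 m.+1.
Proof.
case=> [[lp hp] [jn [lo sn]] sh [shlo [shn shmid]] [cs asclo mn ascmid]].
have [wp Tp] := lp; have s0 := lo 0 isT.
rewrite /layered size_append; split.
- split; first exact: live_append.
  by rewrite has123_append_cold // asc_in_id.
- split=> //; split=> [[|s] js|]; first by rewrite site_append_le // s0 asc_in_id.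
    by rewrite site_append_gt // lo // shut0.
  by rewrite site_append_gt // sn shut0.
- move=> [|v] [|w] // sv sw _ vw; rewrite shut_append_gt //; last by lia.
  have -> : w < size p by lia.
  by rewrite orbT.
- split=> [[|s] js|]; first by rewrite shut0.
    by rewrite shut_append_gt //; [rewrite shlo // ltnn|lia].
  split=> [|[|s]] //; first by rewrite shut_append_gt ?leqnn // shn ltnn.
  rewrite site_append_gt // => /andP[ss _] js.
  by rewrite shut_append_gt ?shmid //; lia.
- split.
  + case=> [|s]; first by rewrite asc_in_id.
    by rewrite site_append_gt // => /andP[ss _] sn'; rewrite asc_in_append_mid // cs.
  + case=> [|s] js; first by rewrite asc_in_append_mid ?asclo.
    by rewrite asc_in_append_gt ?asclo //; lia.
  + by move=> nd; rewrite site_append_gt // shut0 !ltnS; have [->] := mn nd.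
  + case=> [|s] //; rewrite site_append_gt // => /andP[ss _] js.
    by rewrite asc_in_append_gt ?ascmid //; lia.
Qed.

(** The ascents of [p] start at [j] or higher, so all sites up to [s] survive. Above [s], everything
    is shut except the top site, which moves to [(size p).+1]. *)
Lemma site_layered_append_low d p j m s t : layered d p j m -> 0 < s <= j ->
  site (append s p) t = (t <= s) || (t == (size p).+1).
Proof.
case=> [[lp hp] [jn [lo sn]] sh [shlo [shn shmid]] [cs asclo mn ascmid]] sj.
have [wp Tp] := lp; have ss : site p s by apply: lo; lia.
have le_s := site_le ss.
case: (leqP t s) => ts.
  rewrite site_append_le // lo; last by lia.
  apply/negP => /(asc_in_le (leq0n t) (leqnn s)); rewrite cs //; lia.
case: t ts => // t ts; rewrite site_append_gt // eqSS.
have [->|nt] := eqVneq t (size p); first by rewrite sn shlo //; lia.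
case: (boolP (site p t)) => //= st; rewrite sh //; have := site_le st; lia.
Qed.

(** The final run (s-1)...0 and the new [s] form another nontrivial block, with lower end 0. All
    remaining sites below the top are at most [j], hence lie below an older ascent and would be
    killed by the top site; so no special site remains, and the last argument 0 is a dummy. *)
Lemma layered_append_low d p j m s : layered d p j m -> 0 < s <= j ->
  layered true (append s p) 0 0.
Proof.
move=> Hp sj; have Es t := site_layered_append_low t Hp sj.
case: Hp => [[lp hp] [jn [lo sn]] sh [shlo [shn shmid]] [cs asclo mn ascmid]].
have [wp Tp] := lp; have ss : site p s by apply: lo; lia.
have le_s := site_le ss.
rewrite /layered size_append; split.
- split; first exact: live_append.
  by rewrite has123_append_cold // cs //; lia.
- split=> //; split=> [t t0|]; rewrite Es; lia.
- move=> v w; rewrite !Es => sv sw v0 vw.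
  by rewrite shut_append_le //; [apply: sh => //; try apply: lo|]; lia.
- split=> [t|]; first by rewrite leqn0 => /eqP->; rewrite shut0.
  split; first by rewrite shut_append_gt ?shn ?ltnn // leqnn le_s.
  by move=> t; rewrite Es => st tn; rewrite shut_append_mid //; lia.
- split=> //.
  + by move=> t; rewrite Es => st tn; rewrite asc_in_append_le ?cs ?lo //; lia.
  + by move=> t; rewrite leqn0 => /eqP->; rewrite asc_in_append_mid ?asclo.
  + move=> t; rewrite Es => st tn; rewrite asc_in_append_mid ?asclo //; lia.
Qed.

(** Only the top site could create 123, and [shut p s n] with n the size of [p] removes it. *)
Lemma layered_append_mid d p j m s : layered d p j m -> site p s ->
  j < s < size p -> cold (append s p).
Proof.
case=> [[lp hp] [jn [lo sn]] sh [shlo [shn shmid]] [cs asclo mn ascmid]] ss js.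
have [wp Tp] := lp; have le_s := site_le ss.
have Es t : site (append s p) t = (t <= s) && site p t.
  case: (leqP t s) => ts.
    rewrite site_append_le //; case: (boolP (asc_in p t s)); last by rewrite andbT.
    by move/(asc_in_le (leq0n t) (leqnn s)); rewrite cs //; lia.
  case: t ts => // t ts; rewrite site_append_gt //.
  case: (boolP (site p t)) => //= st; have := site_le st; rewrite leq_eqVlt.
  case/predU1P => [->|tn]; first by rewrite shmid.
  by rewrite sh //; lia.
split.
- by split; [apply: live_append|].
- by rewrite has123_append_cold // cs //; lia.
- move=> v w; rewrite !Es => /andP[vs sv] /andP[ws sw] v0 vw.
  by rewrite shut_append_le ?vw // sh //; lia.
- by move=> t; rewrite Es => /andP[ts st]; rewrite asc_in_append_le // cs //; lia.
Qed.

(** The top site is not shut against itself, so it splits. An ascent kills each smaller site except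
    [m], which remains when there is a single block. *)
Lemma layered_append_top d p j m : layered d p j m ->
  let n := size p in
  if d then two_sites false false (append n p) n n.+1
  else three_sites true false (append n p) m n n.+1.
Proof.
case=> [[lp hp] [jn [lo sn]] sh [shlo [shn shmid]] [cs asclo mn ascmid]] n.
have [wp Tp] := lp; have le_n := leqnn n; have n0 : 0 < n by lia.
have [la ha] : live (append n p) /\ has123 (append n p).
  by split; [apply: live_append | rewrite has123_append // asclo].
have Es t : site (append n p) t = [|| ~~ d && (t == m), t == n | t == n.+1].
  case: (leqP t n) => tn; last first.
    case: t tn => // t tn; rewrite site_append_gt //.
    have [->|nt] := eqVneq t n; first by rewrite sn shn !eqxx !orbT.
    suff -> : site p t = false.
      case: (boolP d) => [_|nd] /=; first by lia.
      by have [_] := mn nd; lia.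
    by apply/negP => /site_le; lia.
  rewrite site_append_le //; have [->|nt] := eqVneq t n.
    by rewrite sn asc_in_id orbT.
  have -> : t == n.+1 = false by lia.
  rewrite /= orbF; case: (leqP t j) => tj.
    rewrite asclo // andbF; case: (boolP d) => //= nd; have [_] := mn nd; lia.
  case: (boolP (site p t)) => [st|nst] /=.
    by rewrite ascmid // ?negb_or ?negbK //; lia.
  case: (boolP d) => //= nd; apply/esym/negbTE.
  by apply: contraNneq nst => ->; case: (mn nd).
case: d mn ascmid Es => mn ascmid Es; split=> //.
- by rewrite asc_in_append_mid ?leqnn // asc_in_id ltnn.
- split=> //.
  + by rewrite shut_append_mid ?leqnn // n0 orbT.
  + by rewrite shut_append_le ?leqnn.
  + by rewrite shut_append_gt ?leqnn // shn ltnn.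
  + by rewrite size_append.
- by have [_] := mn isT; lia.
- have [sm jm] := mn isT; split.
  + by rewrite asc_in_append_le ?ascmid ?eqxx //; lia.
  + by rewrite asc_in_append_mid //; lia.
  + by rewrite asc_in_append_mid ?leqnn // asc_in_id ltnn.
- have [sm jm] := mn isT; split.
  + split; first by rewrite shut_append_le ?shmid //; lia.
    by rewrite shut_append_mid ?shmid //; lia.
  + by rewrite shut_append_mid ?leqnn // n0 orbT.
  + by rewrite shut_append_le ?sh //; lia.
  + by rewrite shut_append_le ?leqnn.
  + by rewrite size_append shut_append_gt ?leqnn // shn ltnn.
Qed.

Lemma count_layered d p j m r : layered d p j m -> count_desc mixed p r = n_layered d j r.
Proof.
elim: r d p j m => [|r IH] d p j m Hp;
  have [[lp hp] [jn [lo sn]] sh [shlo [shn shmid]] [cs asclo mn ascmid]] := Hp.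
  by rewrite count_mixed0 ?hp.
pose mids := [seq s <- iota j.+1 (size p - j.+1) | site p s].
(* Site 0 raises [j], the sites 1 to [j] close another block, the top site creates 123, and the
   sites in [mids] lead to cold words. *)
rewrite (@count_mixedS _ _ (0 :: iota 1 j ++ size p :: mids)) //; first last.
- move=> s; rewrite inE mem_cat inE mem_filter !mem_iota.
  case: (leqP s j) => sj; first by rewrite lo //; lia.
  have [->|ns] := eqVneq s (size p); first by rewrite sn !orbT.
  by case: (boolP (site p s)) => [/site_le|]; lia.
- have hmids : ~~ has [in iota 1 j] mids.
    by apply/hasPn => s; rewrite mem_filter !mem_iota; lia.
  rewrite cons_uniq cat_uniq cons_uniq [has _ (_ :: _)]/= (negbTE hmids) !iota_uniq.
  rewrite filter_uniq ?iota_uniq // !(mem_cat, inE) !mem_filter !mem_iota; lia.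
rewrite big_cons big_cat big_cons /= (IH _ _ _ _ (layered_append0 Hp)) -addnA; congr addn.
congr addn.
  rewrite big_seq (eq_bigr (fun=> n_layered true 0 r)) => [|s].
    by rewrite -big_seq big_const_seq count_predT size_iota iter_addn_0 mulnC.
  by rewrite mem_iota => hs; apply: IH (layered_append_low Hp _); lia.
rewrite big_seq big1 => [|s]; last first.
  rewrite mem_filter mem_iota => /andP[ss hs].
  by apply/count_cold/(layered_append_mid Hp ss); lia.
rewrite addn0; have := layered_append_top Hp.
by case: (d) => Ht; [rewrite (count_two_sites00 _ Ht) | rewrite (count_three_sites _ Ht)].
Qed.

(** * A decreasing run below a second decreasing run *)

Fixpoint n_peak (y : bool) (k r : nat) : nat :=
  if r is r'.+1 then
    (if y then n_warm r' else n_layered false 1 r') + k.-1 * n_warm r' +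
    n_peak true k r' + (if y then 2 ^ r' else n_three false false r')
  else 0.

(* The shape is (k-1)...0 followed by a decreasing run of larger entries, which
   is a single entry iff [size p = k.+1]. *)
Definition peak k p : Prop :=
  [/\ live p /\ has123 p = false, 0 < k < size p, forall s, site p s = (s <= k.+1),
      forall u v, u <= v <= k.+1 -> asc_in p u v = (u < k) && (v == k.+1) &
      forall v w, v <= w <= k.+1 -> shut p v w = (0 < v) &&
        [|| w < k, (v <= k) && (w == k.+1) | (v == k.+1) && (k.+1 < size p)]].

Lemma peak_append0_layered k p : peak k p -> k.+1 = size p ->
  layered false (append 0 p) 1 k.+1.
Proof.
case=> [[lp hp] k0 Es Ea Eh] Ek; have [wp Tp] := lp.
have Es' s : site (append 0 p) s = (s <= k.+2).
  case: s => [|s]; first by rewrite site_append_le // Es asc_in_id.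
  by rewrite site_append_gt // Es shut0 andbT.
rewrite /layered size_append -Ek; split.
- split; first by apply: live_append; rewrite ?Es.
  by rewrite has123_append_cold // asc_in_id.
- by split=> //; split=> [s s1|]; rewrite Es' //; nat_lia.
- move=> [|v] [|w] //; rewrite !Es' => sv sw _ vw.
  rewrite shut_append_gt //; [rewrite -Ek|]; nat_lia.
- split=> [[|s] s1|]; first by rewrite shut0.
    by rewrite shut_append_gt // -?Ek ?Eh //; nat_lia.
  split; first by rewrite shut_append_gt ?Eh // -?Ek; nat_lia.
  by move=> [|s] //; rewrite Es' => ss sk; rewrite shut_append_gt ?Eh //; nat_lia.
- split.
  + case=> [|s]; first by rewrite asc_in_id.
    by rewrite Es' => _ sk; rewrite asc_in_append_mid ?Ea //; nat_lia.
  + case=> [|s] s1; first by rewrite asc_in_append_mid ?Ea //; nat_lia.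
    by rewrite asc_in_append_gt ?Ea //; nat_lia.
  + by move=> _; rewrite Es'; nat_lia.
  + case=> [|s] //; rewrite Es' => _ sk.
    by rewrite asc_in_append_gt ?Ea //; nat_lia.
Qed.

Lemma peak_append0_warm k p : peak k p -> k.+1 < size p ->
  warm (append 0 p) k.+2 k.+1.
Proof.
case=> [[lp hp] k0 Es Ea Eh] Ek; have [wp Tp] := lp.
have Es' s : site (append 0 p) s = (s <= k.+2).
  case: s => [|s]; first by rewrite site_append_le // Es asc_in_id.
  by rewrite site_append_gt // Es shut0 andbT.
split.
- by split; [apply: live_append; rewrite ?Es|].
- by rewrite has123_append_cold // asc_in_id.
- move=> [|v] [|w] //; rewrite !Es' => sv sw _ vw.
  rewrite shut_append_gt //; nat_lia.
- split; rewrite ?Es' //.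
  + by move=> v; rewrite Es'.
  + case=> [|v]; first by rewrite asc_in_id.
    by rewrite Es' => vk; rewrite asc_in_append_mid ?Ea //; nat_lia.
  + case=> [|v] ; first by rewrite asc_in_append_mid ?Ea //; nat_lia.
    by rewrite Es' => _ vk; rewrite asc_in_append_gt ?Ea //; nat_lia.
Qed.

(** Of the old sites from [s] upwards only [k] is not shut, and it moves to [k.+1]; this site lies
    above the new ascents, all of which have upper end [s]. *)
Lemma peak_append_low k p s : peak k p -> 0 < s < k -> warm (append s p) k.+1 s.
Proof.
case=> [[lp hp] k0 Es Ea Eh] sk; have [wp Tp] := lp; have le_s : s <= size p by nat_lia.
have ss : site p s by rewrite Es; nat_lia.
have Es' t : site (append s p) t = (t <= s) || (t == k.+1).
  case: (leqP t s) => ts; first by rewrite site_append_le // Es Ea; nat_lia.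
  case: t ts => // t ts; rewrite site_append_gt // Es.
  by case: (leqP t k.+1) => tk; [rewrite Eh|]; nat_lia.
split.
- by split; [exact: live_append|].
- by rewrite has123_append_cold ?Ea //; nat_lia.
- move=> v w; rewrite !Es' => sv sw v0 vw.
  case: (leqP w s) => ws; first by rewrite shut_append_le ?Eh //; nat_lia.
  have -> : w = k.+1 by nat_lia.
  case: (leqP v s) => vs; first by rewrite shut_append_mid ?v0 ?orbT //; nat_lia.
  have -> : v = k.+1 by nat_lia.
  by rewrite shut_append_gt //; nat_lia.
- split; rewrite ?Es'; try lia.
  + by move=> v; rewrite Es'; nat_lia.
  + move=> v; rewrite Es' => sv; case: (leqP v s) => vs.
      by rewrite asc_in_append_le ?Ea //; nat_lia.
    have -> : v = k.+1 by nat_lia.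
    by rewrite asc_in_append_mid ?Ea //; nat_lia.
  + by move=> v; rewrite Es' => sv vk; rewrite asc_in_append_mid ?Ea //; nat_lia.
Qed.

(** The new [k] prolongs the upper run downwards. The old site [k.+1] is shut, but [k] splits and
    replaces it. *)
Lemma peak_append_mid k p : peak k p -> peak k (append k p).
Proof.
case=> [[lp hp] k0 Es Ea Eh]; have [wp Tp] := lp; have le_k : k <= size p by nat_lia.
have sk : site p k by rewrite Es.
split.
- split; first exact: live_append.
  by rewrite has123_append_cold ?Ea //; nat_lia.
- by rewrite size_append; nat_lia.
- move=> t; case: (leqP t k) => tk; first by rewrite site_append_le // Es Ea; nat_lia.
  case: t tk => // t tk; rewrite site_append_gt // Es.
  by case: (leqP t k.+1) => tk'; [rewrite Eh|]; nat_lia.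
- move=> u v uv; case: (leqP v k) => vk.
    by rewrite asc_in_append_le ?Ea //; nat_lia.
  have -> : v = k.+1 by nat_lia.
  case: (leqP u k) => uk; first by rewrite asc_in_append_mid ?Ea //; nat_lia.
  by rewrite asc_in_ge; nat_lia.
- move=> v w vw; rewrite size_append.
  case: (leqP w k) => wk; first by rewrite shut_append_le ?Eh //; nat_lia.
  have -> : w = k.+1 by nat_lia.
  case: (leqP v k) => vk; first by rewrite shut_append_mid ?Eh //; nat_lia.
  have -> : v = k.+1 by nat_lia.
  by rewrite shut_append_gt ?Eh //; nat_lia.
Qed.

Lemma peak_append_top k p : peak k p ->
  if k.+1 < size p then two_sites false true (append k.+1 p) k k.+1
  else three_sites false false (append k.+1 p) k k.+1 k.+2.
Proof.
case=> [[lp hp] k0 Es Ea Eh]; have [wp Tp] := lp.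
have le_k : k.+1 <= size p by nat_lia.
have sk : site p k.+1 by rewrite Es.
have [la ha] : live (append k.+1 p) /\ has123 (append k.+1 p).
  by split; [apply: live_append | rewrite has123_append // Ea; lia].
have Es' t : site (append k.+1 p) t =
    [|| t == k, t == k.+1 | (t == k.+2) && ~~ (k.+1 < size p)].
  case: (leqP t k.+1) => tk; first by rewrite site_append_le // Es Ea; nat_lia.
  case: t tk => // t tk; rewrite site_append_gt // Es.
  by case: (leqP t k.+1) => tk'; [rewrite Eh|]; nat_lia.
case: (boolP (k.+1 < size p)) Es' => sz Es'; split=> //.
- by move=> t; rewrite Es' andbF orbF.
- by rewrite asc_in_append_le ?Ea //; nat_lia.
- by split=> //; rewrite shut_append_le ?Eh //; nat_lia.
- by nat_lia.
- by move=> t; rewrite Es' andbT.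
- split.
  + by rewrite asc_in_append_le ?Ea //; nat_lia.
  + by rewrite asc_in_append_mid ?Ea //; nat_lia.
  + by rewrite asc_in_append_mid ?Ea //; nat_lia.
- split.
  + by split; [rewrite shut_append_le ?Eh // | rewrite shut_append_mid ?Eh //]; nat_lia.
  + by rewrite shut_append_mid ?Eh //; nat_lia.
  + by rewrite shut_append_le ?Eh //; nat_lia.
  + by rewrite shut_append_le ?Eh //; nat_lia.
  + by rewrite shut_append_gt ?Eh ?size_append //; nat_lia.
Qed.

Lemma count_peak k p r : peak k p ->
  count_desc mixed p r = n_peak (k.+1 < size p) k r.
Proof.
elim: r p => [|r IH] p Hp; have [[lp hp] k0 Es Ea Eh] := Hp.
  by rewrite count_mixed0 ?hp.
(* Site 0 gives a warm word, or a layered one if the upper run is a single entry; the sites 1 to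
   [k.-1] give warm words, [k] gives a peak again, and [k.+1] creates 123. *)
rewrite (@count_mixedS _ _ (0 :: iota 1 k.-1 ++ [:: k; k.+1])) //; first last.
- by move=> s; rewrite Es !(mem_cat, inE) mem_iota; nat_lia.
- by rewrite cons_uniq cat_uniq iota_uniq !(mem_cat, inE) /= !inE !mem_iota; nat_lia.
rewrite big_cons big_cat !big_cons big_nil /= addn0.
rewrite (IH _ (peak_append_mid Hp)) size_append.
have -> : k.+1 < (size p).+1 by nat_lia.
rewrite addnA addnA; congr (_ + _ + _ + _).
- case: (boolP (k.+1 < size p)) => sz; first exact: count_warm (peak_append0_warm Hp sz).
  by apply: count_layered (peak_append0_layered Hp _); nat_lia.
- rewrite big_seq (eq_bigr (fun=> n_warm r)) => [|s].
    by rewrite -big_seq big_const_seq count_predT size_iota iter_addn_0 mulnC.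
  by rewrite mem_iota => hs; apply: count_warm (peak_append_low Hp _); nat_lia.
- have := peak_append_top Hp; case: ifP => _ Ht; first exact: count_two_sites01 Ht.
  exact: count_three_sites Ht.
Qed.

(** * Decreasing words, the root of the recursion *)

Fixpoint n_desc (k r : nat) : nat :=
  if r is r'.+1 then
    n_desc k.+1 r' +
    (if k is k'.+1 then k' * n_layered false 0 r' + n_peak false k r' else 0)
  else 0.

Definition descending p : Prop :=
  [/\ live p /\ has123 p = false, forall s, site p s = (s <= size p),
      forall u v, asc_in p u v = false &
      forall v w, v <= w <= size p -> shut p v w = (0 < v) && (w < size p)].

Lemma descending_append0 p : descending p -> descending (append 0 p).
Proof.
case=> [[lp hp] Es Ea Eh]; have [wp Tp] := lp; rewrite /descending size_append.
split.
- by split; [apply: live_append; rewrite ?Es | rewrite has123_append_cold].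
- case=> [|s]; first by rewrite site_append_le // Es Ea.
  by rewrite site_append_gt // Es shut0 andbT.
- by move=> u v; rewrite asc_in_append // !Ea; nat_lia.
- move=> [|v] [|w] // vw; rewrite ?shut0 //.
  by rewrite shut_append_gt ?Eh //; nat_lia.
Qed.

(** The new entry closes the first nontrivial block (s-1)...0 s. All ascents end at [s], so [s] is
    the site that survives the use of the top site. *)
Lemma descending_append_low p s : descending p -> 0 < s < size p ->
  layered false (append s p) 0 s.
Proof.
case=> [[lp hp] Es Ea Eh] sn; have [wp Tp] := lp; have le_s : s <= size p by nat_lia.
have Es' t : site (append s p) t = (t <= s) || (t == (size p).+1).
  case: (leqP t s) => ts; first by rewrite site_append_le // Es Ea; nat_lia.
  case: t ts => // t ts; rewrite site_append_gt // Es.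
  by case: (leqP t (size p)) => tn; [rewrite Eh|]; nat_lia.
rewrite /layered size_append; split.
- by split; [apply: live_append; rewrite ?Es | rewrite has123_append_cold].
- by split=> //; split=> [t t0|]; rewrite Es'; nat_lia.
- move=> v w; rewrite !Es' => sv sw v0 vw.
  by rewrite shut_append_le ?Eh //; nat_lia.
- split=> [t|]; first by rewrite leqn0 => /eqP->; rewrite shut0.
  split; first by rewrite shut_append_gt ?Eh //; nat_lia.
  by move=> t; rewrite Es' => st tn; rewrite shut_append_mid //; nat_lia.
- split.
  + by move=> t; rewrite Es' => st tn; rewrite asc_in_append_le ?Ea //; nat_lia.
  + by move=> t t0; rewrite asc_in_append_mid //; nat_lia.
  + by rewrite Es'; nat_lia.
  + by move=> t; rewrite Es' => st tn; rewrite asc_in_append_mid ?Ea //; nat_lia.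
Qed.

Lemma descending_append_top p : descending p -> 0 < size p ->
  peak (size p) (append (size p) p).
Proof.
case=> [[lp hp] Es Ea Eh] n0; have [wp Tp] := lp; have le_n := leqnn (size p).
rewrite /peak size_append; split.
- by split; [apply: live_append; rewrite ?Es | rewrite has123_append_cold].
- by nat_lia.
- move=> t; case: (leqP t (size p)) => tn.
    by rewrite site_append_le // Es Ea; nat_lia.
  case: t tn => // t tn; rewrite site_append_gt // Es.
  by case: (leqP t (size p)) => tn'; [rewrite Eh|]; nat_lia.
- by move=> u v uv; rewrite asc_in_append // !Ea; nat_lia.
- move=> v w vw; rewrite ltnn andbF orbF.
  case: (leqP w (size p)) => wn; first by rewrite shut_append_le ?Eh //; nat_lia.
  have -> : w = (size p).+1 by nat_lia.
  case: (leqP v (size p)) => vn; first by rewrite shut_append_mid ?Eh //; nat_lia.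
  have -> : v = (size p).+1 by nat_lia.
  by rewrite shut_append_gt ?Eh //; nat_lia.
Qed.

Lemma count_descending p r : descending p ->
  count_desc mixed p r = n_desc (size p) r.
Proof.
elim: r p => [|r IH] p Hp; have [[lp hp] Es Ea Eh] := Hp.
  by rewrite count_mixed0 ?hp.
case: (posnP (size p)) => [p0|p0].
  rewrite (@count_mixedS _ _ [:: 0]) //; last by move=> s; rewrite Es p0 inE leqn0.
  by rewrite big_seq1 (IH _ (descending_append0 Hp)) size_append p0 /= addn0.
rewrite (@count_mixedS _ _ (0 :: iota 1 (size p).-1 ++ [:: size p])) //; first last.
- by move=> s; rewrite Es !(mem_cat, inE) mem_iota; nat_lia.
- by rewrite cons_uniq cat_uniq iota_uniq !(mem_cat, inE) /= !mem_iota; nat_lia.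
rewrite big_cons big_cat big_seq1 /= (IH _ (descending_append0 Hp)) size_append.
rewrite (count_peak _ (descending_append_top Hp p0)) size_append ltnn.
rewrite big_seq (eq_bigr (fun=> n_layered false 0 r)) => [|s].
  rewrite -big_seq big_const_seq count_predT size_iota iter_addn_0 mulnC.
  by case: (size p) p0.
by rewrite mem_iota => hs; apply: count_layered (descending_append_low Hp _); nat_lia.
Qed.

Lemma count_mixed_nil r : count_desc mixed [::] r = n_desc 0 r.
Proof. by apply: (@count_descending [::]); split=> // -[]. Qed.

(** * Words that avoid 123 *)

(** The Catalan generating tree: [h] is the largest last value that creates no 123. Appending 0
    raises it to [h.+1], which is the last term of the sum, and appending [s] in 1..h resets it to
    [s]. *)
Fixpoint n_catalan (h r : nat) : nat :=
  if r is r'.+1 then \sum_(1 <= s < h.+2) n_catalan s r' else 1.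

Definition avoids123 (p : seq nat) : bool := ~~ has123 p.

Lemma count_avoids123 p h r : is_word p -> avoids123 p -> h <= size p ->
  (forall s, s <= size p -> asc_in p 0 s = (h < s)) ->
  count_desc avoids123 p r = n_catalan h r.
Proof.
elim: r p h => [|r IH] p h wp hp le_h Ea /=; first by rewrite hp.
have has s : s <= size p -> avoids123 (append s p) = (s <= h).
  by move=> le_s; rewrite /avoids123 has123_append // Ea // (negbTE hp) orbF -leqNgt.
rewrite (@big_cat_nat _ _ _ h.+1) //= [X in _ + X]big_nat [X in _ + X]big1 => [|s hs].
  rewrite addn0 big_ltn //.
  have -> : count_desc avoids123 (append 0 p) r = n_catalan h.+1 r.
    apply: IH; rewrite ?has ?size_append //; first exact: is_word_append.
    case=> [|s] le_s; first by rewrite asc_in_id.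
    by rewrite asc_in_append_mid // Ea //; nat_lia.
  rewrite [RHS]big_nat_recr //= addnC; congr addn.
  rewrite !big_nat; apply: eq_bigr => s hs; have le_s : s <= size p by nat_lia.
  apply: IH; rewrite ?has ?size_append //; try lia.
    exact: is_word_append.
  move=> v le_v; case: (leqP v s) => vs.
    by rewrite asc_in_append_le ?Ea //; nat_lia.
  by case: v vs le_v => // v vs le_v; rewrite asc_in_append_mid //; nat_lia.
apply: (@count_desc0 has123).
- by move=> t q le_t; apply: has123_appendW.
- by move=> q; rewrite negbK.
- by rewrite -[has123 _]negbK -/(avoids123 _) has; nat_lia.
Qed.

Lemma count_avoids123_nil r : count_desc avoids123 [::] r = n_catalan 0 r.
Proof. by apply: count_avoids123 => // -[]. Qed.

(** * Permutations and words *)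

Lemma occ2P R p : occ2 R p <->
  exists i j, i < j < size p /\ R (nth 0 p j) (nth 0 p i).
Proof.
elim: p => [|x p IH] /=; first by split=> // -[i [j []]]; lia.
split=> [/orP[/hasP[y /(nthP 0)[j jp <-] Ry]|/IH[i [j [ij Rij]]]]|].
- by exists 0, j.+1.
- by exists i.+1, j.+1.
case=> -[|i] [[|j] [ij Rij]] //; last by apply/orP; right; apply/IH; exists i, j.
by apply/orP; left; apply/hasP; exists (nth 0 p j) => //; apply: mem_nth.
Qed.

Lemma occ3P R p : occ3 R p <->
  exists i j k, [&& i < j, j < k & k < size p] /\ R (nth 0 p k) (nth 0 p j) (nth 0 p i).
Proof.
elim: p => [|x p IH] /=; first by split=> // -[i [j [k []]]]; lia.
split=> [/orP[/occ2P[i [j [ij Rij]]]|/IH[i [j [k [ijk Rijk]]]]]|].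
- by exists 0, i.+1, j.+1.
- by exists i.+1, j.+1, k.+1.
case=> -[|i] [[|j] [[|k] [ijk Rijk]]] //; try lia.
  by apply/orP; left; apply/occ2P; exists j, k.
by apply/orP; right; apply/IH; exists i, j, k.
Qed.

Lemma occ4P R p : occ4 R p <->
  exists i j k l, [&& i < j, j < k, k < l & l < size p] /\
    R (nth 0 p l) (nth 0 p k) (nth 0 p j) (nth 0 p i).
Proof.
elim: p => [|x p IH] /=; first by split=> // -[i [j [k [l []]]]]; lia.
split=> [/orP[/occ3P[i [j [k [ijk Rijk]]]]|/IH[i [j [k [l [ijkl Rl]]]]]]|].
- by exists 0, i.+1, j.+1, k.+1.
- by exists i.+1, j.+1, k.+1, l.+1.
case=> -[|i] [[|j] [[|k] [[|l] [ijkl Rl]]]] //; try lia.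
  by apply/orP; left; apply/occ3P; exists j, k, l.
by apply/orP; right; apply/IH; exists i, j, k, l.
Qed.

Section Word.
Variable n : nat.
Implicit Type pi : 'S_n.

Definition word pi : seq nat := rev [seq val (pi i) | i <- enum 'I_n].

Lemma size_word pi : size (word pi) = n.
Proof. by rewrite size_rev size_map size_enum_ord. Qed.

Lemma nth_word pi (i : 'I_n) : nth 0 (word pi) i = pi (rev_ord i).
Proof.
rewrite nth_rev size_map size_enum_ord //.
rewrite (nth_map i) ?size_enum_ord ?ltn_subrL ?(leq_ltn_trans _ (ltn_ord i)) //.
by rewrite (nth_ord_enum i (rev_ord i)).
Qed.

Lemma occ4_wordP R pi : occ4 R (word pi) <->
  exists i j k l : 'I_n, [&& i < j, j < k & k < l] /\ R (pi i) (pi j) (pi k) (pi l).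
Proof.
split=> [/occ4P[i [j [k [l []]]]]|[i [j [k [l [ijkl Rl]]]]]].
  rewrite size_word => ijkl.
  have [hi hj hk hl] : [/\ i < n, j < n, k < n & l < n] by split; lia.
  rewrite (nth_word pi (Ordinal hi)) (nth_word pi (Ordinal hj)).
  rewrite (nth_word pi (Ordinal hk)) (nth_word pi (Ordinal hl)) => Rl.
  exists (rev_ord (Ordinal hl)), (rev_ord (Ordinal hk)), (rev_ord (Ordinal hj)),
    (rev_ord (Ordinal hi)); split=> //=; lia.
apply/occ4P; exists (rev_ord l), (rev_ord k), (rev_ord j), (rev_ord i).
rewrite size_word !nth_word !rev_ordK; split=> //=.
move: (ltn_ord i) (ltn_ord j) (ltn_ord k) (ltn_ord l) ijkl; lia.
Qed.
End Word.

Lemma word_lift_perm n (s : 'I_n.+1) (pi : 'S_n) :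
  word (lift_perm ord_max s pi) = append s (word pi).
Proof.
rewrite /word enum_ordSr map_rcons rev_rcons lift_perm_id /append map_rev -!map_comp.
congr (_ :: rev _); apply: eq_map => i /=.
have -> : widen_ord (leqnSn n) i = lift ord_max i by apply/val_inj/esym/lift_max.
by rewrite lift_perm_lift.
Qed.

(** A permutation is determined by its last value and the pattern of the other entries: the map is
    injective between sets of equal size. *)
Lemma sum_permS n (F : 'S_n.+1 -> nat) :
  \sum_pi F pi = \sum_(pi : 'S_n) \sum_(s < n.+1) F (lift_perm ord_max s pi).
Proof.
rewrite pair_big (reindex (fun u : 'S_n * 'I_n.+1 => lift_perm ord_max u.2 u.1)) //=.
apply/onW_bij/inj_card_bij => [[pi s] [pi' s'] /= E|]; last first.
  by rewrite card_prod card_ord !card_Sn factS mulnC.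
have Es : s = s' by have := congr1 (fun t : 'S__ => t ord_max) E; rewrite !lift_perm_id.
congr (_, _) => //; apply/permP => i.
have := congr1 (fun t : 'S__ => t (lift ord_max i)) E.
by rewrite !lift_perm_lift Es => /lift_inj.
Qed.

(** The induction trades one entry of the permutation for one step of appending; with [r = 0] this
    counts permutations by their words. *)
Lemma sum_count_desc_word Q m r :
  \sum_(pi : 'S_m) count_desc Q (word pi) r = count_desc Q [::] (m + r).
Proof.
elim: m r => [|m IH] r.
  rewrite (eq_bigr (fun=> count_desc Q [::] r)) => [|pi _].
    by rewrite sum_nat_const card_Sn mul1n.
  by rewrite /word (size0nil (size_enum_ord 0)).
rewrite sum_permS addSnnS -IH; apply: eq_bigr => pi _ /=.
rewrite size_word big_mkord; apply: eq_bigr => s _.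
by rewrite word_lift_perm.
Qed.

Lemma card_count_desc Q n :
  #|[set pi : 'S_n | Q (word pi)]| = count_desc Q [::] n.
Proof.
rewrite -[n in RHS]addn0 -sum_count_desc_word /= -sum1_card big_mkcond /=.
by apply: eq_bigr => pi _; rewrite inE; case: (Q _).
Qed.

Lemma onelineE n (pi : 'S_n) v :
  oneline pi = v -> forall i : 'I_n, (pi i).+1 = nth 0 v i.
Proof.
move=> <- i; rewrite /oneline /image_mem (nth_map i) -?cardE ?card_ord //.
by rewrite nth_ord_enum.
Qed.

Lemma oneline_exists n v : uniq v -> size v = n -> all (fun x => 0 < x <= n) v ->
  exists pi : 'S_n, oneline pi = v.
Proof.
case: n => [|n] uv sv av.
  exists 1%g; rewrite /oneline /image_mem (size0nil (size_enum_ord 0)).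
  by rewrite (size0nil sv).
have vb (i : 'I_n.+1) : 0 < nth 0 v i <= n.+1.
  by apply: (allP av); rewrite mem_nth // sv.
(* One-line notation uses the values from 1, hence the predecessor; [inord] requires the nonempty
   ordinal type obtained by treating n = 0 apart. *)
pose f (i : 'I_n.+1) : 'I_n.+1 := inord (nth 0 v i).-1.
have fE i : (f i).+1 = nth 0 v i by rewrite /f inordK; have := vb i; lia.
have finj : injective f.
  move=> i j Eij; apply/val_inj/eqP => /=.
  have: nth 0 v i == nth 0 v j by rewrite -!fE Eij.
  by rewrite nth_uniq // sv.
exists (perm finj); rewrite /oneline /image_mem.
rewrite (eq_map (fun i => _ : _ = nth 0 v (val i))) => [|i]; last by rewrite permE fE.
by rewrite (map_comp (nth 0 v) val) val_enum_ord map_nth_iota0 ?sv // -sv take_size.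
Qed.

Lemma contains4P n (pi : 'S_n) (tau : 'S_4) v : oneline tau = v ->
  contains pi tau <-> exists i j k l : 'I_n, [&& i < j, j < k & k < l] /\
    forall x y, x < 4 -> y < 4 ->
      (nth 0 [:: val (pi i); val (pi j); val (pi k); val (pi l)] x
        < nth 0 [:: val (pi i); val (pi j); val (pi k); val (pi l)] y)
      = (nth 0 v x < nth 0 v y).
Proof.
move=> Ev; split.
  case/existsP => f /andP[/forallP incr /forallP iso].
  have lt (x y : 'I_4) : x < y -> f x < f y.
    by have /forallP/(_ y)/implyP := incr x; apply.
  exists (f (inord 0)), (f (inord 1)), (f (inord 2)), (f (inord 3)); split.
    by rewrite !lt ?inordK.
  move=> x y x4 y4; rewrite -(onelineE Ev (Ordinal x4)) -(onelineE Ev (Ordinal y4)).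
  have /forallP/(_ (Ordinal y4))/eqP := iso (Ordinal x4); rewrite !ltnS => <-.
  have nthE z (z4 : z < 4) : nth 0 [:: val (pi (f (inord 0))); val (pi (f (inord 1)));
      val (pi (f (inord 2))); val (pi (f (inord 3)))] z = pi (f (Ordinal z4)).
    by case: z z4 => [|[|[|[|]]]] // z4 /=; congr (val (pi (f _)));
      apply: val_inj; rewrite /= inordK.
  by rewrite !nthE.
case=> i [j [k [l [ijkl iso]]]].
pose f := [ffun x : 'I_4 => nth i [:: i; j; k; l] x].
apply/existsP; exists f; apply/andP; split.
  apply/forallP => -[x x4]; apply/forallP => -[y y4]; apply/implyP; rewrite !ffunE /=.
  by case: x x4 => [|[|[|[|]]]] //; case: y y4 => [|[|[|[|]]]] //=; lia.
have fE (x : 'I_4) :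
    nth 0 [:: val (pi i); val (pi j); val (pi k); val (pi l)] x = pi (f x).
  by rewrite ffunE; case: x => [[|[|[|[|]]]]].
apply/forallP => x; apply/forallP => y; rewrite -!fE iso //.
by rewrite -!(onelineE Ev) ltnS.
Qed.

Lemma avoidersE n : avoiders n T_1324_2341_4123 = [set pi | avoidsT (word pi)].
Proof.
apply/setP => pi; rewrite !inE /avoidsT; apply/idP/idP.
  move=> /forallP avT; apply/negP => /occ4_wordP[i [j [k [l [ijkl bad]]]]].
  have [v vT iso] : exists2 v,
      v \in [:: [:: 1; 3; 2; 4]; [:: 2; 3; 4; 1]; [:: 4; 1; 2; 3]] &
      forall x y, x < 4 -> y < 4 ->
      (nth 0 [:: val (pi i); val (pi j); val (pi k); val (pi l)] x
        < nth 0 [:: val (pi i); val (pi j); val (pi k); val (pi l)] y)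
      = (nth 0 v x < nth 0 v y).
    case/or3P: bad => bad; [exists [:: 1; 3; 2; 4] | exists [:: 2; 3; 4; 1]
      | exists [:: 4; 1; 2; 3]] => //;
    by move=> [|[|[|[|x]]]] [|[|[|[|y]]]] //= _ _; lia.
  have [tau Etau] : exists tau : 'S_4, oneline tau = v.
    by move: vT; rewrite !inE => /or3P[] /eqP->; apply: oneline_exists.
  have /implyP := avT tau; rewrite inE Etau vT => /(_ isT)/negP; apply.
  by apply/(contains4P _ Etau); exists i, j, k, l.
move=> nbad; apply/forallP => tau; apply/implyP; rewrite inE => tauT.
apply: contra nbad => /(contains4P _ erefl)[i [j [k [l [ijkl iso]]]]].
apply/occ4_wordP; exists i, j, k, l; split=> //; move: tauT iso; rewrite /badT.
(* All twelve comparisons of distinct positions are made explicit for [lia]. *)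
have pairs (P : nat -> nat -> Prop) : (forall x y, x < 4 -> y < 4 -> P x y) ->
    [/\ P 0 1, P 0 2, P 0 3, P 1 2 & P 1 3] /\ P 2 3 /\
    [/\ P 1 0, P 2 0, P 3 0, P 2 1 & P 3 1] /\ P 3 2.
  by move=> H; do !split; apply: H.
rewrite !inE => /or3P[] /eqP -> /pairs /= [[? ? ? ? ?] [? [[? ? ? ? ?] ?]]]; lia.
Qed.

(* Affine parameters and the linear system *)
From mathcomp Require Import all_algebra ring.
Import GRing.Theory.

(** The slopes in the integer parameter: [m_layered] for [n_layered] with either value of [d],
    [m_warm] for [n_peak] with either value of [y], and [m_desc] for [n_desc]. They turn the
    recursions in two variables into finitely many sequences. *)
Fixpoint m_layered r :=
  if r is r'.+1 then m_layered r' + n_layered true 0 r' else 0.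

Fixpoint m_warm r := if r is r'.+1 then n_warm r' + m_warm r' else 0.

Fixpoint m_desc r :=
  if r is r'.+1 then m_desc r' + n_layered false 0 r' + m_warm r' else 0.

Lemma n_layeredE d j r : n_layered d j r = n_layered d 0 r + j * m_layered r.
Proof.
elim: r d j => [|r IH] d j /=; first by rewrite muln0.
by rewrite (IH d j.+1) (IH d 1); ring.
Qed.

Lemma n_peakE y k r : n_peak y k.+1 r = n_peak y 1 r + k * m_warm r.
Proof.
elim: r y => [|r IH] y /=; first by rewrite muln0.
by rewrite IH; ring.
Qed.

Lemma n_descE k r : n_desc k.+1 r = n_desc 1 r + k * m_desc r.
Proof.
elim: r k => [|r IH] k /=; first by rewrite muln0.
rewrite (IH k.+1) (IH 1) n_peakE; ring.
Qed.

Local Open Scope ring_scope.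

Section Solve.
Variables (R : comNzRingType) (x : R).
Variables (a o t01 t00 t11 t10 t2 e w z m y r q p v d : R).
Hypotheses (Ea : a = 1 + x * (a + a)) (Eo : o = 1 + x * o).
Hypotheses (E01 : t01 = 1 + x * (a + t01 + a)) (E00 : t00 = 1 + x * (a + t01 + t00)).
Hypotheses (E11 : t11 = 1 + x * (o + t11 + a)) (E10 : t10 = 1 + x * (o + t11 + t00)).
Hypotheses (E2 : t2 = 1 + x * (a + t00)) (Ee : e = 1 + x * (e + o)).
Hypotheses (Ew : w = x * (w + e)).
Hypotheses (Ez : z = x * (z + m + t2)) (Em : m = x * (m + z)).
Hypotheses (Ey : y = x * (y + m + t10)).
Hypotheses (Er : r = x * (w + r + a)) (Eq : q = x * (w + q)).
Hypotheses (Ep : p = x * (y + m + r + t00)) (Ev : v = x * (v + y + q)).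
Hypotheses (Ed : d = x * (d + v + p)).

Let isolate (f g : R) : f = x * f + g -> f * (1 - x) = g.
Proof. by move=> Ef; rewrite mulrBr mulr1 {1}Ef; ring. Qed.

(** Apart from self-references the system is triangular, except that [z] and [m] depend on each
    other. Every solution is stated multiplied by its denominator, so that no division occurs. *)
Lemma solve_system : d * ((1 - x) ^+ 6 * (1 - 2 * x) ^+ 2) =
  x ^+ 2 - 3 * x ^+ 3 + 3 * x ^+ 4 - 5 * x ^+ 5 + 9 * x ^+ 6 - 4 * x ^+ 7.
Proof.
have Ha : a * (1 - 2 * x) = 1.
  by rewrite mulrBr mulr1 {1}Ea; ring.
have Ho : o * (1 - x) = 1 by apply: isolate; rewrite {1}Eo; ring.
have H01 : t01 * ((1 - x) * (1 - 2 * x)) = 1.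
  rewrite mulrA (@isolate _ (1 + x * (2 * a))); last by rewrite {1}E01; ring.
  by rewrite mulrDl mul1r -!mulrA Ha; ring.
have H00 : t00 * ((1 - x) ^+ 2 * (1 - 2 * x)) = 1 - x + x ^+ 2.
  transitivity ((1 - x) * (1 - 2 * x) * (t00 * (1 - x))); first by ring.
  rewrite (@isolate _ (1 + x * (a + t01))); last by rewrite {1}E00; ring.
  transitivity ((1 - x) * (1 - 2 * x) +
    x * (a * (1 - 2 * x) * (1 - x) + t01 * ((1 - x) * (1 - 2 * x)))); first by ring.
  by rewrite Ha H01; ring.
have H11 : t11 * ((1 - x) ^+ 2 * (1 - 2 * x)) = 1 - x - x ^+ 2.
  transitivity ((1 - x) * (1 - 2 * x) * (t11 * (1 - x))); first by ring.
  rewrite (@isolate _ (1 + x * (o + a))); last by rewrite {1}E11; ring.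
  transitivity ((1 - x) * (1 - 2 * x) +
    x * (a * (1 - 2 * x) * (1 - x) + o * (1 - x) * (1 - 2 * x))); first by ring.
  by rewrite Ha Ho; ring.
have H10 : t10 * ((1 - x) ^+ 2 * (1 - 2 * x)) = 1 - x.
  rewrite E10; transitivity ((1 - x) ^+ 2 * (1 - 2 * x) +
    x * (o * (1 - x) * ((1 - x) * (1 - 2 * x)) + t11 * ((1 - x) ^+ 2 * (1 - 2 * x))
       + t00 * ((1 - x) ^+ 2 * (1 - 2 * x)))); first by ring.
  by rewrite Ho H11 H00; ring.
have H2 : t2 * ((1 - x) ^+ 2 * (1 - 2 * x)) = 1 - 2 * x + 2 * x ^+ 2.
  rewrite E2; transitivity ((1 - x) ^+ 2 * (1 - 2 * x) +
    x * (a * (1 - 2 * x) * (1 - x) ^+ 2 + t00 * ((1 - x) ^+ 2 * (1 - 2 * x)))).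
    by ring.
  by rewrite Ha H00; ring.
have He : e * (1 - x) ^+ 2 = 1.
  rewrite expr2 mulrA (@isolate e (1 + x * o)); last by rewrite {1}Ee; ring.
  by rewrite mulrDl mul1r -mulrA Ho; ring.
have Hw : w * (1 - x) ^+ 3 = x.
  rewrite exprS mulrA (@isolate _ (x * e)); last by rewrite {1}Ew; ring.
  by rewrite -mulrA He mulr1.
have Hm' : m * (1 - x) = x * z by apply: isolate; rewrite {1}Em; ring.
have Hz : z * ((1 - x) * (1 - 2 * x) ^+ 2) = x - 2 * x ^+ 2 + 2 * x ^+ 3.
  have Hzx : z * (1 - x) = x * (m + t2) by apply: isolate; rewrite {1}Ez; ring.
  (* Eliminating [m] produces (1 - x)^2 - x^2 = 1 - 2x. *)
  have Hz' : z * (1 - 2 * x) = x * (1 - x) * t2.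
    transitivity ((1 - x) * (z * (1 - x)) - x * (x * z)); first by ring.
    by rewrite Hzx -Hm'; ring.
  transitivity (z * (1 - 2 * x) * ((1 - x) * (1 - 2 * x))); first by ring.
  rewrite Hz'; transitivity (x * (t2 * ((1 - x) ^+ 2 * (1 - 2 * x)))); first by ring.
  by rewrite H2; ring.
have Hm : m * ((1 - x) ^+ 2 * (1 - 2 * x) ^+ 2) = x ^+ 2 - 2 * x ^+ 3 + 2 * x ^+ 4.
  transitivity (m * (1 - x) * ((1 - x) * (1 - 2 * x) ^+ 2)); first by ring.
  by rewrite Hm' -mulrA Hz; ring.
have Hy : y * ((1 - x) ^+ 3 * (1 - 2 * x) ^+ 2) =
    x - 3 * x ^+ 2 + 3 * x ^+ 3 - 2 * x ^+ 4 + 2 * x ^+ 5.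
  transitivity (y * (1 - x) * ((1 - x) ^+ 2 * (1 - 2 * x) ^+ 2)); first by ring.
  rewrite (@isolate _ (x * (m + t10))); last by rewrite {1}Ey; ring.
  transitivity (x * (m * ((1 - x) ^+ 2 * (1 - 2 * x) ^+ 2)
    + t10 * ((1 - x) ^+ 2 * (1 - 2 * x)) * (1 - 2 * x))); first by ring.
  by rewrite Hm H10; ring.
have Hr : r * ((1 - x) ^+ 4 * (1 - 2 * x)) = x - 2 * x ^+ 2 + x ^+ 3 - x ^+ 4.
  transitivity (r * (1 - x) * ((1 - x) ^+ 3 * (1 - 2 * x))); first by ring.
  rewrite (@isolate _ (x * (w + a))); last by rewrite {1}Er; ring.
  transitivity (x * (w * (1 - x) ^+ 3 * (1 - 2 * x) + a * (1 - 2 * x) * (1 - x) ^+ 3)).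
    by ring.
  by rewrite Hw Ha; ring.
have Hq : q * (1 - x) ^+ 4 = x ^+ 2.
  rewrite exprS mulrA (@isolate _ (x * w)); last by rewrite {1}Eq; ring.
  by rewrite -mulrA Hw; ring.
have Hp : p * ((1 - x) ^+ 4 * (1 - 2 * x) ^+ 2) =
    x - 3 * x ^+ 2 + 3 * x ^+ 3 - 4 * x ^+ 4 + 6 * x ^+ 5 - 2 * x ^+ 6.
  rewrite Ep; transitivity (x * (y * ((1 - x) ^+ 3 * (1 - 2 * x) ^+ 2) * (1 - x)
    + m * ((1 - x) ^+ 2 * (1 - 2 * x) ^+ 2) * (1 - x) ^+ 2
    + r * ((1 - x) ^+ 4 * (1 - 2 * x)) * (1 - 2 * x)
    + t00 * ((1 - x) ^+ 2 * (1 - 2 * x)) * ((1 - x) ^+ 2 * (1 - 2 * x)))); first by ring.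
  by rewrite Hy Hm Hr H00; ring.
have Hv : v * ((1 - x) ^+ 5 * (1 - 2 * x) ^+ 2) =
    x ^+ 2 - 3 * x ^+ 3 + 2 * x ^+ 4 - x ^+ 5 + 4 * x ^+ 6 - 2 * x ^+ 7.
  transitivity (v * (1 - x) * ((1 - x) ^+ 4 * (1 - 2 * x) ^+ 2)); first by ring.
  rewrite (@isolate _ (x * (y + q))); last by rewrite {1}Ev; ring.
  transitivity (x * (y * ((1 - x) ^+ 3 * (1 - 2 * x) ^+ 2) * (1 - x)
    + q * (1 - x) ^+ 4 * (1 - 2 * x) ^+ 2)); first by ring.
  by rewrite Hy Hq; ring.
transitivity (d * (1 - x) * ((1 - x) ^+ 5 * (1 - 2 * x) ^+ 2)); first by ring.
rewrite (@isolate _ (x * (v + p))); last by rewrite {1}Ed; ring.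
transitivity (x * (v * ((1 - x) ^+ 5 * (1 - 2 * x) ^+ 2)
  + p * ((1 - x) ^+ 4 * (1 - 2 * x) ^+ 2) * (1 - x))); first by ring.
by rewrite Hv Hp; ring.
Qed.
End Solve.

(** * Coefficients of power series *)

Section Coefs.
Variable K : fieldType.
Implicit Types f g : fps K.

Lemma coefs_XM0 f : coefs (fps_X K * f) 0 = 0.
Proof. by rewrite [LHS]big_ord1 mul0r. Qed.

Lemma coefs_XMS f n : coefs (fps_X K * f) n.+1 = coefs f n.
Proof.
rewrite [LHS]big_ord_recl /= mul0r add0r big_ord_recl /= mul1r subSS subn0.
by rewrite big1 ?addr0 // => i _; rewrite mul0r.
Qed.

Lemma coefsD f g n : coefs (f + g) n = coefs f n + coefs g n.
Proof. by []. Qed.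

Lemma coefs1 n : coefs (1 : fps K) n = (n == 0)%:R.
Proof. by case: n. Qed.

Lemma coefs_sum (I : Type) (s : seq I) (F : I -> fps K) n :
  coefs (\sum_(i <- s) F i) n = \sum_(i <- s) coefs (F i) n.
Proof.
elim: s => [|i s IH]; first by rewrite !big_nil; case: n.
by rewrite !big_cons coefsD IH.
Qed.

Lemma fps_mulXI : injective (fun f => fps_X K * f).
Proof.
move=> f g fg; apply: fpsP => n.
by rewrite -(coefs_XMS f) -(coefs_XMS g) (fg : fps_X K * f = fps_X K * g).
Qed.
End Coefs.

(** * Generating functions *)

Definition gf (f : nat -> nat) : fps rat := FPS (fun n => (f n)%:R).

Lemma gfD f g : gf (fun r => f r + g r)%N = gf f + gf g.
Proof. by apply: fpsP => n; rewrite coefsD /= natrD. Qed.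

Lemma gf_rec0 f g : f 0%N = 0%N -> (forall r, f r.+1 = g r) -> gf f = fps_X rat * gf g.
Proof.
by move=> f0 fS; apply: fpsP => -[|n]; rewrite ?coefs_XM0 ?coefs_XMS /= ?f0 ?fS.
Qed.

Lemma gf_rec1 f g : f 0%N = 1%N -> (forall r, f r.+1 = g r) ->
  gf f = 1 + fps_X rat * gf g.
Proof.
move=> f0 fS; apply: fpsP => -[|n].
  by rewrite coefsD coefs1 coefs_XM0 /= f0 addr0.
by rewrite coefsD coefs1 coefs_XMS /= fS add0r.
Qed.

Lemma gf_desc (x := fps_X rat) :
  gf (n_desc 0) * ((1 - x) ^+ 6 * (1 - 2 * x) ^+ 2) =
  x ^+ 3 - 3 * x ^+ 4 + 3 * x ^+ 5 - 5 * x ^+ 6 + 9 * x ^+ 7 - 4 * x ^+ 8.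
Proof.
(* The empty word has the single site 0. This first step contributes a factor x, and the system is
   solved for words of size 1 onwards. *)
rewrite (@gf_rec0 _ (n_desc 1)) // => [|r]; last by rewrite /= addn0.
rewrite -mulrA (@solve_system _ x (gf (expn 2)) (gf (fun=> 1%N))
  (gf (n_three false true)) (gf (n_three false false))
  (gf (n_three true true)) (gf (n_three true false)) (gf n_two) (gf S)
  (gf n_warm) (gf (n_layered true 0)) (gf m_layered) (gf (n_layered false 0))
  (gf (n_peak true 1)) (gf m_warm) (gf (n_peak false 1)) (gf m_desc)) -/x; first by ring.
(* Each equation of the system is a recursion read coefficientwise; those that raise the parameter
   use its affine form. *)
all: rewrite -?gfD; first [apply: gf_rec1 | apply: gf_rec0] => //= r.
- by rewrite expnS mul2n -addnn.
- by rewrite addn1.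
- by rewrite mul0n addn0 n_layeredE mul1n.
- by rewrite mul0n addn0 n_layeredE mul1n.
- by rewrite mul0n addn0.
- by rewrite mul0n addn0 n_layeredE mul1n.
- by rewrite n_descE mul1n mul0n.
Qed.

(** * The Catalan series *)

Lemma catalan_gf_quadratic : catalan_gf = 1 + fps_X rat * catalan_gf ^+ 2.
Proof.
set x := fps_X rat; set c := catalan_gf.
have sqr : (1 - 2 * x * c) ^+ 2 = 1 - 4 * x.
  rewrite catalan_gfE opprB addrC subrK fps_sqrtK //.
  by rewrite -mulrN mulrC mulNr -mulrN coefsD coefs1 coefs_XM0 addr0.
have u4 : (4 : fps rat) \is a GRing.unit by [].
(* The square root identity yields the quadratic equation multiplied by 4x; 4 is a unit and
   multiplication by x is injective. *)
apply/(mulrI u4)/fps_mulXI; rewrite -/x /=.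
have -> : x * (4 * c) = 1 + (2 * x * c) ^+ 2 - (1 - 2 * x * c) ^+ 2 by ring.
by rewrite sqr; ring.
Qed.

(** This is the recursion of [n_catalan], with the power h+1 of C as generating function at label
    [h]. The induction step multiplies C = 1 + x C^2 by a power of C. *)
Lemma catalan_gf_expS h :
  catalan_gf ^+ h.+1 = 1 + fps_X rat * \sum_(1 <= s < h.+2) catalan_gf ^+ s.+1.
Proof.
elim: h => [|h IH]; first by rewrite big_nat1 expr1 -catalan_gf_quadratic.
rewrite big_nat_recr //= mulrDr addrA -IH exprS {1}catalan_gf_quadratic.
by rewrite !exprS; ring.
Qed.

Lemma coefs_catalan_gf h r : coefs (catalan_gf ^+ h.+1) r = (n_catalan h r)%:R.
Proof.
elim: r h => [|r IH] h; rewrite catalan_gf_expS coefsD coefs1.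
  by rewrite coefs_XM0 addr0.
rewrite coefs_XMS add0r coefs_sum /= natr_sum.
by apply: eq_bigr => s _.
Qed.

(** * Assembling the two classes *)

Lemma avoids123_avoidsT p : avoids123 p -> avoidsT p.
Proof.
apply: contra; rewrite /has123; apply: occ4_123 => a b c d.
by rewrite /badT /mono123; lia.
Qed.

Lemma card_avoiders n :
  #|avoiders n T_1324_2341_4123| = (n_catalan 0 n + n_desc 0 n)%N.
Proof.
rewrite avoidersE -count_avoids123_nil -count_mixed_nil -!card_count_desc.
rewrite -(cardsID [set pi | avoids123 (word pi)] [set pi | avoidsT (word pi)]).
congr addn.
  by apply: eq_card => pi; rewrite !inE andbC; apply/andb_idr/avoids123_avoidsT.
by apply: eq_card => pi; rewrite !inE negbK.
Qed.

Theorem theorem3p1 :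
  let x : fps rat := fps_X rat in
  perm_gf T_1324_2341_4123 =
    catalan_gf
    + (x ^+ 3 - 3 * x ^+ 4 + 3 * x ^+ 5 - 5 * x ^+ 6 + 9 * x ^+ 7 - 4 * x ^+ 8)
      / ((1 - x) ^+ 6 * (1 - 2 * x) ^+ 2).
Proof.
move=> x; rewrite -gf_desc mulrK; last first.
  (* Both bases in the denominator have this form, with constant term 1. *)
  have unit1 (f : fps rat) : 1 - x * f \is a GRing.unit.
    by rewrite fps_unitE -mulrN coefsD coefs1 coefs_XM0 addr0 oner_eq0.
  rewrite unitrM; apply/andP; split; apply: unitrX.
    by move: (unit1 1); rewrite mulr1.
  by rewrite [2 * x]mulrC unit1.
apply: fpsP => n; rewrite coefsD -[catalan_gf]expr1 coefs_catalan_gf /=.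
by rewrite card_avoiders natrD.
Qed.
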